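(* Let $K=\mathbb{Q}(\sqrt{d})$ be a real quadratic field with $d$ a square-free positive integer. Assume the prime $p$ remains prime in $K/\mathbb{Q}$, let $u$ be the fundamental unit of $K$, and let $k\ge 1$ denote an integer. (1) If one also assumes that $N(u)=-1$ when $p=2$, then for any prime $p$ the ray class number of $K$ mod $p^k$ is $$|Cl_K^{p^k}|=\begin{cases}\dfrac{(p^2-1)p^{k-2+m_{d,p}}}{s_{d,p}}\cdot |Cl_K^1| & \text{if } k\geq m_{d,p},\\[2mm] \dfrac{p^{2k-2}(p^2-1)}{s_{d,p}}\cdot |Cl_K^1| & \text{if } k\leq m_{d,p}.\end{cases}$$ (2) In the case $p=2$ and $N(u)=1$, one has $|Cl_K^{2^{k+1}}|=2\,|Cl_K^{2^k}|$ for any $k\geq \nu_2(u^6-1)$.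
   Context: $N$ is the norm from $K$ to $\mathbb{Q}$ and $\nu_p$ is the valuation of $K$ at the prime $p\mathcal{O}_K$. For an ideal $\mathfrak{m}$ of $\mathcal{O}_K$, $Cl_K^{\mathfrak{m}}$ is the narrow ray class group: fractional ideals prime to $\mathfrak{m}$ modulo principal ideals with a totally positive generator $\equiv 1\bmod\mathfrak{m}$; $Cl_K^1$ is the big (narrow) class group, the case $\mathfrak{m}=1$. $\mathcal{O}^*_+$ is the group of totally positive units of $\mathcal{O}_K$, $\mathcal{O}_+^{p}$ is the subgroup of totally positive units $\equiv 1\bmod p$, and $u_0$ is the generator of $\mathcal{O}^*_+$, namely $u_0=u$ if $N(u)=1$ and $u_0=u^2$ otherwise (with $u>0$). Define $s_{d,p}=|\mathcal{O}^*_+/\mathcal{O}^p_+|$, i.e. the smallest positive integer with $u_0^{s_{d,p}}\equiv 1\bmod p$, and $m_{d,p}=\nu_p(u_0^{s_{d,p}}-1)$. *)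

(* Defs.v *)
From HB Require Import structures.
From mathcomp Require Import all_boot all_order all_algebra all_field.
From mathcomp Require Import finmap.
From mathcomp Require Import all_classical reals.
Set Implicit Arguments.
Unset Strict Implicit.
Unset Printing Implicit Defensive.
Import Order.TTheory GRing.Theory Num.Theory.
Local Open Scope classical_set_scope.
Local Open Scope ring_scope.

Definition squarefree (d : nat) : Prop :=
  forall m : nat, (m ^ 2 %| d)%N -> m = 1%N.

(* [fset_set] is [fset0] on infinite sets, so the cardinal of an infinite set is
   0; it is only used on finite quotients. *)
Definition set_card (T : choiceType) (A : set T) : nat := #|` fset_set A|%fset.

(* Underlying set of the quotient G / H: the cosets g H for g in G. *)
Definition cosets (T : Type) (op : T -> T -> T) (G H : set T) : set (set T) :=
  [set [set op g h | h in H] | g in G].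

Definition OK (K : splittingFieldType rat) : set K :=
  [set x | integralOver (intr : int -> K) x].

Definition units (K : splittingFieldType rat) : set K :=
  [set x | OK x /\ exists2 y, OK y & x * y = 1].

Definition normQ (K : splittingFieldType rat) (x : K) : K :=
  galNorm 1%AS {: K}%AS x.

(* Subsets of K play the role of fractional ideals; integral ideals are
   those contained in OK. *)

Definition fractional_ideal (K : splittingFieldType rat) (I : set K) : Prop :=
  [/\ exists2 x, I x & x != 0,
      forall x y, I x -> I y -> I (x + y),
      forall a x, OK a -> I x -> I (a * x)
    & exists c, [/\ OK c, c != 0 & forall x, I x -> OK (c * x)]].

Definition integral_ideal (K : splittingFieldType rat) (I : set K) : Prop :=
  fractional_ideal I /\ I `<=` @OK K.

Definition principal (K : splittingFieldType rat) (a : K) : set K :=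
  [set a * x | x in @OK K].

Definition ideal_add (K : splittingFieldType rat) (I J : set K) : set K :=
  [set z | exists x y, [/\ I x, J y & z = x + y]].

Definition ideal_mul (K : splittingFieldType rat) (I J : set K) : set K :=
  [set z | exists s : seq (K * K),
     (forall xy, xy \in s -> I xy.1 /\ J xy.2) /\
     z = \sum_(xy <- s) xy.1 * xy.2].

Definition coprime_ideal (K : splittingFieldType rat) (I J : set K) : Prop :=
  ideal_add I J = @OK K.

Definition prime_ideal (K : splittingFieldType rat) (P : set K) : Prop :=
  [/\ integral_ideal P, P <> @OK K
    & forall x y, OK x -> OK y -> P (x * y) -> P x \/ P y].

(* I = A / B with A and B integral ideals prime to m. *)
Definition prime_to (K : splittingFieldType rat) (m : set K) : set (set K) :=
  [set I | fractional_ideal I /\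
     exists A B, [/\ integral_ideal A, integral_ideal B,
       coprime_ideal A m, coprime_ideal B m & ideal_mul I B = A]].

(* Multiplicative congruence a = 1 mod m in K^*. *)
Definition cong1 (K : splittingFieldType rat) (m : set K) (a : K) : Prop :=
  exists b c, [/\ OK b /\ b != 0, OK c /\ c != 0,
    coprime_ideal (principal b) m /\ coprime_ideal (principal c) m,
    m (b - c) & a = b / c].

Definition totally_positive (R : realType) (K : splittingFieldType rat)
    (x : K) : Prop :=
  forall sigma : {rmorphism K -> R}, 0 < sigma x.

Definition ray (R : realType) (K : splittingFieldType rat) (m : set K) :
    set (set K) :=
  [set principal a | a in [set a | totally_positive R a /\ cong1 m a]].

Definition Cl (R : realType) (K : splittingFieldType rat) (m : set K) :
    set (set (set K)) :=
  cosets (@ideal_mul K) (prime_to m) (ray R m).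

Definition units_pos (R : realType) (K : splittingFieldType rat) : set K :=
  [set x | units x /\ totally_positive R x].

Definition units_pos_mod (R : realType) (K : splittingFieldType rat)
    (p : nat) : set K :=
  [set x | units_pos R x /\ principal p%:R (x - 1)].

Definition s_dp (R : realType) (K : splittingFieldType rat) (p : nat) : nat :=
  set_card (cosets *%R (@units_pos R K) (@units_pos_mod R K p)).

(* Valuation at the ideal p OK, assumed prime: p is then a uniformizer of the
   localization, so nu_p x is the n such that x = p ^ n * (a / b) with a, b in
   OK outside p OK.  The value at 0 is junk. *)
Definition nu (K : splittingFieldType rat) (p : nat) (x : K) : int :=
  xget 0 [set n : int | exists a b, [/\ (@OK K `\` principal p%:R) a,
    (@OK K `\` principal p%:R) b & x = p%:R ^ n * (a / b)]].

Definition fundamental_unit (R : realType) (K : splittingFieldType rat)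
    (iota : {rmorphism K -> R}) (u : K) : Prop :=
  [/\ units u, 0 < iota u
    & forall v, units v -> exists n : int, v = u ^ n \/ v = - u ^ n].

Definition u0 (K : splittingFieldType rat) (u : K) : K :=
  if normQ u == 1 then u else u ^+ 2.

Definition m_dp (R : realType) (K : splittingFieldType rat) (p : nat)
    (u : K) : int :=
  nu p (u0 u ^+ s_dp R K p - 1).

(* Main.v *)
(* The totally positive c = 1 mod p^k act by scaling on fractional ideals,
   and ray classes are the orbits: two ideals have the same
   narrow class iff they differ by a totally positive scalar.  Since p is inert,
   an ideal is prime to p^k iff its elements have minimal valuation 0 at p, a
   condition that does not depend on k and that scaling by the totally positive
   power p^n always achieves.  So Cl^(p^k) -> Cl^1 is onto, and all its fibers
   are copies of (O / p^k)^* modulo the powers of u0; an ideal is only fixed by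
   units because c I = I makes all powers of c have a common denominator.
   Hence |Cl^(p^k)| t_k = p^(2k-2) (p^2 - 1) |Cl^1|, where t_k is the order of
   u0 mod p^k, and this also holds (as 0 = 0) should the sets be infinite.
   Lifting the exponent gives t_k; for p = 2 and N(u) = -1 it applies because u0
   is a square, which forces m_{d,p} >= 2.  The valuation m_{d,p} is finite
   because Pell's equation provides a unit of infinite order. *)
Require Import Defs.
From HB Require Import structures.
From mathcomp Require Import all_boot all_order all_algebra all_field.
From mathcomp Require Import finmap.
From mathcomp Require Import all_classical reals.
From mathcomp Require Import ring lra zify.
Set Implicit Arguments.
Unset Strict Implicit.
Unset Printing Implicit Defensive.
Import Order.TTheory GRing.Theory Num.Theory.
Local Open Scope classical_set_scope.
Local Open Scope ring_scope.

(** * Integers of a quadratic field *)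

(** No factorization of ideals is used. All work at [p] is done by hand in the localization: an
    integer outside [p O] is invertible mod [p ^ k] because its norm is an integer prime to [p], so
    Bezout in Z and the conjugate give the inverse. The shape of [O] matters only for counting:
    residues mod [p ^ k] are pairs of digits in an integral basis. Multiplication by the generator
    permutes the invertible residues in orbits of one common length [t_k], so a number of orbits
    replaces the index of a subgroup. Each orbit has a totally positive representative, since adding
    a large multiple of [p ^ k] makes both embeddings positive. In part (2) [m_{d,p}] can be 1, and
    lifting the exponent from [u ^ t_1] then fails. The exponent 6 repairs this: there are 3
    invertible residues mod 2, so [u ^ 3 = 1] mod 2 and [u ^ 6 = 1] mod 4, after which each squaring
    adds exactly one factor 2. *)

Section Integers.
Variable K : splittingFieldType rat.
Implicit Types x y : K.

Lemma OK_int (z : int) : OK (z%:~R : K).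
Proof. exact: integral_id. Qed.

Lemma OK_nat n : OK (n%:R : K).
Proof. exact: integral_nat. Qed.

Lemma OK0 : OK (0 : K). Proof. exact: integral0. Qed.
Lemma OK1 : OK (1 : K). Proof. exact: integral1. Qed.

Lemma OKD x y : OK x -> OK y -> OK (x + y).
Proof. exact: integral_add. Qed.

Lemma OKN x : OK x -> OK (- x).
Proof. exact: integral_opp. Qed.

Lemma OKB x y : OK x -> OK y -> OK (x - y).
Proof. exact: integral_sub. Qed.

Lemma OKM x y : OK x -> OK y -> OK (x * y).
Proof. exact: integral_mul. Qed.

Lemma OKX x n : OK x -> OK (x ^+ n).
Proof.
by move=> Ox; elim: n => [|n IH]; rewrite ?expr0 ?exprS; [exact: OK1|exact: OKM].
Qed.

Lemma OK_rmorph (f : {rmorphism K -> K}) x : OK x -> OK (f x).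
Proof.
case=> q mon_q qx0; exists q => //.
suff -> : map_poly intr q = map_poly f (map_poly (intr : int -> K) q).
  by rewrite fmorph_root.
by rewrite -map_poly_comp; apply: eq_map_poly => z /=; rewrite rmorph_int.
Qed.

(** Gauss's lemma: [X - a] divides a monic integral polynomial, so it is [c] times an integral
    factor [p1]. The leading coefficient of [p1] is a unit of Z, hence [c] is 1 or -1 and [a] is
    read off the constant term. *)
Lemma OK_rat (a : rat) : OK (a%:A : K) -> exists z : int, a = z%:~R.
Proof.
case=> q mon_q.
have -> : map_poly intr q = map_poly (in_alg K) (map_poly (intr : int -> rat) q).
  by rewrite -map_poly_comp; apply: eq_map_poly => z /=; rewrite -[_%:A]/(in_alg K _) rmorph_int.
rewrite -[a%:A]/(in_alg K a) fmorph_root -dvdp_XsubCl.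
case/dvdpP_rat_int => p1 [c c0 Dp] [r Dq].
have lead1 : lead_coef p1 * lead_coef r = 1.
  by rewrite -lead_coefM -Dq; apply/eqP.
have lp : lead_coef p1 \is a GRing.unit.
  by apply/unitrP; exists (lead_coef r); rewrite mulrC lead1.
have c1 : c * (lead_coef p1)%:~R = 1.
  have := congr1 lead_coef Dp; rewrite lead_coefXsubC lead_coefZ.
  by rewrite lead_coef_map_inj => // x y /intr_inj.
have cE : c = (lead_coef p1)%:~R.
  have ll : lead_coef p1 * lead_coef p1 = 1 by case/orP: lp => /eqP ->.
  have ll' : (lead_coef p1)%:~R * (lead_coef p1)%:~R = 1 :> rat.
    by rewrite -rmorphM /= ll.
  by rewrite -[LHS]mulr1 -[X in _ * X = _]ll' mulrA c1 mul1r.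
exists (- (lead_coef p1 * p1`_0)).
have := congr1 (fun s : {poly rat} => s`_0) Dp.
rewrite /= coefZ coefB coefX coefC /= coef_map /= sub0r => /eqP.
by rewrite eqr_oppLR cE -rmorphM -rmorphN => /eqP.
Qed.

Lemma in_alg_nat n : (n%:R : rat)%:A = n%:R :> K.
Proof. by rewrite -[LHS]/(in_alg K _) rmorph_nat. Qed.

Lemma in_alg_int (z : int) : (z%:~R : rat)%:A = z%:~R :> K.
Proof. by rewrite -[LHS]/(in_alg K _) rmorph_int. Qed.

Lemma in_algM (a b : rat) : (a * b)%:A = a%:A * b%:A :> K.
Proof. by rewrite -[LHS]/(in_alg K _) rmorphM. Qed.

Lemma K_intr_inj : injective (intr : int -> K).
Proof.
move=> a b; rewrite -!in_alg_int -[_%:A]/(in_alg K _) -[X in _ = X]/(in_alg K _).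
by move/fmorph_inj/intr_inj.
Qed.

Lemma K_natr_eq0 n : (n%:R == 0 :> K) = (n == 0%N).
Proof.
apply/eqP/eqP => [|->//]; rewrite -[n%:R]/(n%:~R) -[0]/(0%:~R).
by move/K_intr_inj => [].
Qed.

Lemma rmorph_in_alg (F : fieldType) (f : {rmorphism K -> F}) (a : rat) :
  f (a%:A : K) = (numq a)%:~R / (denq a)%:~R.
Proof.
rewrite -{1}[a]divq_num_den -[_%:A]/(in_alg K _) rmorphM fmorphV !rmorph_int.
by rewrite rmorphM fmorphV !rmorph_int.
Qed.

End Integers.

(** * Coordinates, conjugation and norm in Q(sqrt d) *)

Section Quadratic.
Variables (d : nat) (K : splittingFieldType rat) (sqrtd : K).
Hypothesis d_sqf : squarefree d.
Hypothesis d_gt1 : (1 < d)%N.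
Hypothesis sqrtd2 : sqrtd ^+ 2 = d%:R.
Hypothesis K_gen : (<<1%VS; sqrtd>> = {: K})%VS.

(** A rational square root of [d] is integral, hence an integer [z]; then [z ^ 2] divides [d] and
    square-freeness forces [d = 1]. *)
Lemma sqrtd_irrat (a : rat) : a%:A != sqrtd.
Proof.
apply/eqP => aE.
have : OK (a%:A : K).
  exists ('X^2 - d%:R%:P); first by rewrite monicXnsubC.
  rewrite rmorphB /= map_polyXn map_polyC /root !hornerE aE sqrtd2.
  by rewrite raddfMn subrr.
case/OK_rat => z az.
have : ((z ^+ 2)%:~R : K) = (d%:Z)%:~R.
  by rewrite rmorphXn /= -in_alg_int -az aE sqrtd2.
move/K_intr_inj => zd.
have : (`|z| ^ 2)%N = d by rewrite -abszX zd absz_nat.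
move=> zd'; have := @d_sqf `|z|%N; rewrite zd' dvdnn => /(_ isT) z1.
by move: d_gt1; rewrite -zd' z1.
Qed.

Lemma quad_coord (x : K) : exists a b : rat, x = a%:A + b%:A * sqrtd.
Proof.
have : x \in <<1%VS; sqrtd>>%VS by rewrite K_gen memvf.
case/Fadjoin_polyP => q /polyOverP q1 ->; rewrite horner_coef.
elim/big_ind: _ => [|y z [a [b ->]] [a' [b' ->]]|i _].
- by exists 0, 0; rewrite scale0r mul0r addr0.
- by exists (a + a'), (b + b'); rewrite !scalerDl mulrDl addrACA.
have /vlineP[c ->] := q1 i.
rewrite -[nat_of_ord i]odd_double_half exprD -muln2 mulnC exprM sqrtd2.
rewrite -natrX -in_alg_nat; case: (odd i) => /=.
  exists 0, (c * (d ^ i./2)%:R).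
  by rewrite scale0r add0r expr1 in_algM mulrA mulrAC.
exists (c * (d ^ i./2)%:R), 0.
by rewrite scale0r mul0r addr0 expr0 mul1r in_algM.
Qed.

Lemma sqrtd_neq0 : sqrtd != 0.
Proof. by rewrite -[0](scale0r 1) eq_sym sqrtd_irrat. Qed.

Lemma quad_coord_inj (a b a' b' : rat) :
  a%:A + b%:A * sqrtd = a'%:A + b'%:A * sqrtd -> a = a' /\ b = b'.
Proof.
move=> E.
have E2 : (a - a')%:A = (b' - b)%:A * sqrtd :> K.
  by rewrite !scalerBl mulrBl; apply/eqP; rewrite subr_eq addrAC eq_sym subr_eq E addrC.
have [bb|bb] := eqVneq b b'.
  move: E2; rewrite bb subrr scale0r mul0r -[_%:A]/(in_alg K _) => /eqP.
  by rewrite fmorph_eq0 subr_eq0 => /eqP.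
have b0 : in_alg K (b' - b) != 0 by rewrite fmorph_eq0 subr_eq0 eq_sym.
have := sqrtd_irrat ((a - a') / (b' - b)).
rewrite -[_%:A]/(in_alg K _) rmorphM fmorphV /= E2 -[_%:A]/(in_alg K _).
by rewrite mulrC mulKf ?eqxx.
Qed.

(** An automorphism is determined by its value at [sqrtd], which is [sqrtd] or [- sqrtd]. If the
    second value never occurred, [sqrtd] would lie in the fixed field of the Galois group, that is
    in Q. The product defining [normQ] therefore has exactly two factors. *)
Lemma exists_conj : exists tau : {rmorphism K -> K},
  tau sqrtd = - sqrtd /\ forall x, normQ x = x * tau x.
Proof.
have gal1 (g : gal_of {: K}%VS) (a : rat) : g (a%:A : K) = a%:A.
  by rewrite linearZ /= rmorph1.
have galE (g h : gal_of {: K}%VS) : g sqrtd = h sqrtd -> g = h.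
  move=> gh; apply/eqP/gal_eqP => x _; have [a [b ->]] := quad_coord x.
  by rewrite !rmorphD !rmorphM /= !gal1 gh.
have gal_sq (g : gal_of {: K}%VS) : g sqrtd = sqrtd \/ g sqrtd = - sqrtd.
  have /eqP := congr1 g sqrtd2; rewrite rmorphXn rmorph_nat -sqrtd2.
  by rewrite eqf_sqr => /orP[] /eqP ->; [left|right].
have galK : galois 1%VS {: K}%VS.
  apply/and3P; split; [exact: sub1v| |exact: normalFieldf].
  apply/separableP => y _; apply: pcharf0_separable => q.
  by rewrite pchar_lalg pchar_num.
have all_gal (g : gal_of {: K}%VS) : g \in 'Gal({: K} / 1)%g.
  rewrite gal_kHom ?sub1v //; apply/kAHomP => x /vlineP[a ->]; exact: gal1.
have [[g gN]|allfix] := pselect (exists g : gal_of {: K}%VS, g sqrtd = - sqrtd).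
  exists g; split => // x; rewrite /normQ /galNorm.
  have Ng : g != 1%g.
    apply/eqP => g1; move: gN; rewrite g1 gal_id => /eqP.
    by rewrite -addr_eq0 -mulr2n -mulr_natr mulf_eq0 (negPf sqrtd_neq0) K_natr_eq0.
  rewrite (bigD1 (1%g : gal_of {: K}%VS)) ?all_gal //= (bigD1 g) ?all_gal //= gal_id big1 ?mulr1 //.
  move=> h /andP[/andP[_ h1] hg]; case: (gal_sq h) => hE.
    by case/eqP: h1; apply: galE; rewrite gal_id.
  by case/eqP: hg; apply: galE; rewrite gN.
have : sqrtd \in fixedField 'Gal({: K} / 1)%g.
  apply/fixedFieldP; first exact: memvf.
  by move=> g _; case: (gal_sq g) => // gN; case: allfix; exists g.
rewrite (galois_fixedField galK) => /vlineP[a aE].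
by have /eqP := sqrtd_irrat a; rewrite aE.
Qed.

End Quadratic.

(** If [b] is the denominator of [r], then [b ^ n] divides [D] for every [n]; already [n = |D|]
    leaves only [b = 1]. This is the rational case of [OK_powers]. *)
Lemma rat_int_pow (D : int) (r : rat) : D != 0 ->
  (forall n : nat, exists z : int, D%:~R * r ^+ n = z%:~R) -> exists z : int, r = z%:~R.
Proof.
move=> D0 Dr; suff b1 : `|denq r|%N = 1%N.
  exists (numq r); rewrite -{1}[r]divq_num_den.
  have -> : denq r = 1 by rewrite -[denq r]gez0_abs ?denq_ge0 // b1.
  by rewrite divr1.
have dvd n : (`|denq r| ^ n %| `|D|)%N.
  have [z Dz] := Dr n.
  have E : D * numq r ^+ n = z * denq r ^+ n.
    apply: (@intr_inj rat); rewrite !rmorphM !rmorphXn /= -Dz.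
    by rewrite -{2}[r]divq_num_den exprMn exprVn mulrA divfK // expf_neq0 // intr_eq0 denq_eq0.
  have : (`|denq r| ^ n %| `|D| * `|numq r| ^ n)%N.
    by rewrite -!abszX -!abszM E abszM dvdn_mull.
  rewrite Gauss_dvdl // coprimeXl // coprimeXr // coprime_sym.
  exact: coprime_num_den.
have := dvdn_leq _ (dvd `|D|%N); rewrite absz_gt0 => /(_ D0).
have : (0 < `|denq r|)%N by rewrite absz_gt0 denq_eq0.
case: `|denq r|%N => [//|[//|b]] _; by rewrite leqNgt ltn_expl.
Qed.

(** * Traces, norms and an integral basis *)

Section Conj.
Variables (d : nat) (K : splittingFieldType rat) (sqrtd : K).
Hypothesis d_sqf : squarefree d.
Hypothesis d_gt1 : (1 < d)%N.
Hypothesis sqrtd2 : sqrtd ^+ 2 = d%:R.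
Hypothesis K_gen : (<<1%VS; sqrtd>> = {: K})%VS.
Variable tau : {rmorphism K -> K}.
Hypothesis tau_sqrtd : tau sqrtd = - sqrtd.
Implicit Types x y : K.

Let coord := quad_coord sqrtd2 K_gen.
Let coord_inj := quad_coord_inj d_sqf d_gt1 sqrtd2.

Lemma tau_rat (a : rat) : tau a%:A = a%:A.
Proof.
by rewrite rmorph_in_alg -[in RHS](divq_num_den a) -[RHS]/(in_alg K _) fmorph_div !rmorph_int.
Qed.

Lemma tauK : involutive tau.
Proof.
move=> x; have [a [b ->]] := coord x.
by rewrite !(rmorphD, rmorphM) /= !tau_rat tau_sqrtd rmorphN tau_sqrtd opprK.
Qed.

Lemma tau_fixed x : tau x = x -> exists a : rat, x = a%:A.
Proof.
have [a [b ->]] := coord x.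
rewrite !(rmorphD, rmorphM) /= !tau_rat tau_sqrtd mulrN -mulNr -scaleNr.
case/coord_inj => _ /eqP; rewrite eq_sym -addr_eq0 -mulr2n mulrn_eq0 /= => /eqP ->.
by exists a; rewrite scale0r mul0r addr0.
Qed.

Lemma OK_tau x : OK x -> OK (tau x).
Proof. exact: OK_rmorph. Qed.

Lemma OK_fixed x : OK x -> tau x = x -> exists z : int, x = z%:~R.
Proof.
move=> Ox /tau_fixed[a xE]; move: Ox; rewrite xE => /OK_rat[z ->].
by exists z; rewrite in_alg_int.
Qed.

Lemma OK_trace x : OK x -> exists t : int, x + tau x = t%:~R.
Proof.
move=> Ox; apply: OK_fixed; first exact: OKD (OK_tau Ox).
by rewrite rmorphD tauK addrC.
Qed.

Lemma OK_norm x : OK x -> exists n : int, x * tau x = n%:~R.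
Proof.
move=> Ox; apply: OK_fixed; first exact: OKM (OK_tau Ox).
by rewrite rmorphM tauK mulrC.
Qed.

Lemma trace_norm_OK x (t n : int) :
  x + tau x = t%:~R -> x * tau x = n%:~R -> OK x.
Proof.
move=> xt xn; exists ('X^2 + ((- t)%:P * 'X + n%:P)).
  rewrite monicE lead_coefDl ?lead_coefXn // size_polyXn.
  apply: leq_ltn_trans (_ : 2 < 3)%N => //.
  rewrite (leq_trans (size_polyD _ _)) // geq_max (leq_trans (size_polyC_leq1 _)) // andbT.
  by rewrite (leq_trans (size_polyMleq _ _)) // size_polyX addn2 /= ltnS size_polyC_leq1.
rewrite !rmorphD /= map_polyXn rmorphM /= !map_polyC map_polyX /root !hornerE /=.
by rewrite rmorphN /= -xt -xn; apply/eqP; ring.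
Qed.

Lemma norm_eq0 x : (x * tau x == 0) = (x == 0).
Proof. by rewrite mulf_eq0 fmorph_eq0 orbb. Qed.

(** Complete integral closedness of [O]. The norm [D] of [y] is also a common denominator, for the
    powers of [x] and of its conjugate; hence [D ^ 2] clears all powers of the trace and of the norm
    of [x]. These are rational, so [rat_int_pow] makes them integers. *)
Lemma OK_powers x y : y != 0 -> (forall n, OK (y * x ^+ n)) -> OK x.
Proof.
move=> y0 yx; have Oy : OK y by have := yx 0%N; rewrite expr0 mulr1.
have [D DE] := OK_norm Oy.
have D0 : D != 0.
  by apply: contraNneq y0 => D0; rewrite -norm_eq0 DE D0.
have Dx n : OK (D%:~R * x ^+ n).
  by rewrite -DE [y * _]mulrC -mulrA; apply: OKM => //; apply: OK_tau.
have Dtx n : OK (D%:~R * tau x ^+ n).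
  by rewrite -rmorphXn -(rmorph_int tau) -rmorphM; apply: OK_tau.
have Dxtx i j : OK ((D ^+ 2)%:~R * (x ^+ i * tau x ^+ j)).
  by rewrite expr2 rmorphM mulrACA; apply: OKM.
have int_of (r : rat) :
    (forall n, OK ((D ^+ 2)%:~R * r%:A ^+ n : K)) -> exists z : int, r = z%:~R.
  move=> Or; apply: (@rat_int_pow (D ^+ 2)); first exact: expf_neq0.
  move=> n; apply: (@OK_rat K); rewrite in_algM in_alg_int.
  have -> : (r ^+ n)%:A = r%:A ^+ n :> K by rewrite -[LHS]/(in_alg K _) rmorphXn.
  exact: Or.
have [t tE] : exists a : rat, x + tau x = a%:A.
  by apply: tau_fixed; rewrite rmorphD tauK addrC.
have [n nE] : exists a : rat, x * tau x = a%:A.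
  by apply: tau_fixed; rewrite rmorphM tauK mulrC.
have [zt tz] : exists z : int, t = z%:~R.
  apply: int_of => m; rewrite -tE exprDn mulr_sumr.
  elim/big_ind: _ => [|? ? ? ?|i _]; [exact: OK0|exact: OKD|].
  by rewrite mulrnAr -mulr_natr; apply: OKM; [exact: Dxtx|exact: OK_nat].
have [zn nz] : exists z : int, n = z%:~R.
  by apply: int_of => m; rewrite -nE exprMn; exact: Dxtx.
by apply: (@trace_norm_OK x zt zn); rewrite ?tE ?nE ?tz ?nz in_alg_int.
Qed.

(** The square of the denominator of [r] divides [d]. *)
Lemma squarefree_rat (r : rat) (z : int) : r ^+ 2 * d%:R = z%:~R -> exists s : int, r = s%:~R.
Proof.
move=> rz; exists (numq r).
have E : numq r ^+ 2 * d%:Z = z * denq r ^+ 2.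
  apply: (@intr_inj rat); rewrite !expr2 !rmorphM /= numqE -rz /=; ring.
have : (`|denq r| ^ 2 %| `|numq r| ^ 2 * d)%N.
  by rewrite -!abszX -[X in (_ * X)%N]absz_nat -abszM E abszM dvdn_mull.
rewrite Gauss_dvdr; last by rewrite coprimeXl // coprimeXr // coprime_sym coprime_num_den.
move/d_sqf => b1; rewrite -{1}[r]divq_num_den.
have -> : denq r = 1 by rewrite -[denq r]gez0_abs ?denq_ge0 // b1.
by rewrite divr1.
Qed.

(** The generator is [(1 + sqrtd) / 2] if [d = 1] mod 4 and [sqrtd] otherwise. It is kept
    existential so that later arguments do not split on [d]; [w != tau w] is what gives linear
    independence. *)
Lemma OK_basis : exists2 w, OK w & w != tau w /\
  forall x, OK x -> exists a b : int, x = a%:~R + b%:~R * w.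
Proof.
have n2 : (2%:R : K) != 0 by rewrite K_natr_eq0.
have n4 : (4%:R : K) != 0 by rewrite K_natr_eq0.
(* With [x = a + b sqrtd], trace [t] and norm [n], [(2 b) ^ 2 * d] is the integer [t ^ 2 - 4 n], so
   [2 b] is an integer [s]. *)
have half x : OK x -> exists t s n : int,
    x = (t%:~R + s%:~R * sqrtd) / 2%:R /\ t * t - d%:Z * (s * s) = 4 * n.
  move=> Ox; have [t tE] := OK_trace Ox; have [n nE] := OK_norm Ox.
  have [a [b xE]] := coord x.
  have tauE : tau x = a%:A - b%:A * sqrtd.
    by rewrite xE rmorphD rmorphM !tau_rat tau_sqrtd mulrN.
  have aE : a = t%:~R / 2%:R.
    apply: (fmorph_inj (in_alg K)); rewrite fmorph_div rmorph_int rmorph_nat -tE tauE xE.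
    by rewrite /=; field.
  have bE : (2%:R * b) ^+ 2 * d%:R = (t * t - 4 * n)%:~R.
    apply: (fmorph_inj (in_alg K)); rewrite !(rmorphM, rmorphXn) rmorph_int rmorph_nat.
    rewrite rmorphB !rmorphM /= -tE -nE tauE xE.
    by rewrite in_alg_nat -sqrtd2; ring.
  have [s sE] := squarefree_rat bE.
  exists t, s, n; split.
    have -> : (s%:~R : K) = 2%:R * b%:A by rewrite -in_alg_int -sE in_algM in_alg_nat.
    have -> : (t%:~R : K) = 2%:R * a%:A.
      by rewrite -[2%:R]in_alg_nat -in_algM aE mulrC divfK // in_alg_int.
    by rewrite xE; field.
  apply: (@intr_inj rat); move: bE; rewrite sE => bE.
  rewrite rmorphB !rmorphM /=; move: bE; rewrite rmorphB !rmorphM /= => bE.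
  by rewrite -expr2 mulrC bE; ring.
have sqN : sqrtd != - sqrtd.
  by rewrite -addr_eq0 -mulr2n -mulr_natr mulf_neq0 // (sqrtd_neq0 d_sqf d_gt1).
have parity (z : int) : exists a : int, z = 2 * a \/ z = 2 * a + 1.
  exists (z %/ 2)%Z; have := divz_eq z 2; have := ltz_pmod z (isT : 0 < 2 :> int).
  by have := modz_ge0 z (isT : 2 != 0 :> int); lia.
have d4 : ~~ (4 %| d)%N by apply/negP => /(@d_sqf 2).
have [d1|d1] := boolP (d %% 4 == 1)%N.
  pose w := (1 + sqrtd) / 2%:R; exists w.
    apply: (@trace_norm_OK _ 1 (- (d %/ 4)%N%:Z)).
      rewrite /w fmorph_div rmorphD rmorph1 tau_sqrtd rmorph_nat.
      by field.
    rewrite /w fmorph_div rmorphD rmorph1 tau_sqrtd rmorph_nat rmorphN /=.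
    have : (d%:R : K) = (d %/ 4)%:R * 4%:R + 1.
      by rewrite -natrM natr1 {1}(divn_eq d 4) (eqP d1) addn1.
    rewrite -sqrtd2 => dE.
    have -> : (1 + sqrtd) / 2%:R * ((1 - sqrtd) / 2%:R) = (1 - sqrtd ^+ 2) / (2%:R * 2%:R).
      by field; rewrite n2 n4.
    by rewrite dE; field; rewrite ?n2 ?n4.
  split.
    apply: contra sqN => /eqP; rewrite /w fmorph_div rmorphD rmorph1 tau_sqrtd rmorph_nat.
    by move/(mulIf (invr_neq0 n2))/addrI => {1}->.
  move=> x /half[t [s [n [xE tsn]]]].
  (* For [d = 1] mod 4, [t ^ 2 - d s ^ 2 = 0] mod 4 forces [t] and [s] to have the same parity. *)
  have [q qE] : exists q : int, t = q * 2 + s.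
    pose e := (d %/ 4)%N%:Z; have dE : d%:Z = 4 * e + 1 by rewrite /e; lia.
    have [a [] tE] := parity t; have [b [] sE] := parity s; move: tsn; rewrite dE tE sE => tsn.
    - by exists (a - b); lia.
    - by exfalso; lia.
    - by exfalso; lia.
    - by exists (a - b); lia.
  exists q, s; rewrite xE /w qE.
  by rewrite rmorphD rmorphM /=; field; rewrite ?n2.
exists sqrtd.
  apply: (@trace_norm_OK _ 0 (- d%:Z)); first by rewrite tau_sqrtd subrr.
  by rewrite tau_sqrtd mulrN -expr2 sqrtd2 rmorphN.
split; first by rewrite tau_sqrtd.
move=> x /half[t [s [n [xE tsn]]]].
(* Here [d] is 2 or 3 mod 4, the value 0 being excluded by square-freeness, and then
   [t ^ 2 = d s ^ 2] mod 4 forces both to be even. *)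
have [q [r [qE rE]]] : exists q r : int, t = q * 2 /\ s = r * 2.
  have [e dE] : exists e : int, d%:Z = 4 * e + 2 \/ d%:Z = 4 * e + 3.
    by exists (d %/ 4)%N%:Z; lia.
  have [a [] tE] := parity t; have [b [] sE] := parity s; first by exists a, b; lia.
  1-3: by exfalso; move: tsn; rewrite tE sE; case: dE => ->; lia.
exists q, r; rewrite xE qE rE !rmorphM /=; by field; rewrite ?n2.
Qed.

End Conj.

(** * The inert prime *)

(** The interface through which valuations, ideals, residues and orders see [K]: [d] and [sqrtd]
    reappear only for the fundamental unit. *)
Record quadratic (K : splittingFieldType rat) (tau : {rmorphism K -> K}) : Prop :=
  Quadratic {
    conjK : involutive tau;
    norm_int : forall x : K, OK x -> exists n : int, x * tau x = n%:~R;
    OK_of_powers : forall x y : K, y != 0 -> (forall n, OK (y * x ^+ n)) -> OK x;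
    OK_denom : forall x : K, exists2 n : nat, n != 0%N & OK (n%:R * x);
    integral_basis : exists2 w, OK w & w != tau w /\
      forall x : K, OK x -> exists a b : int, x = a%:~R + b%:~R * w }.

Lemma quadraticP (d : nat) (K : splittingFieldType rat) (sqrtd : K)
    (tau : {rmorphism K -> K}) :
  squarefree d -> (1 < d)%N -> sqrtd ^+ 2 = d%:R ->
  (<<1%VS; sqrtd>> = {: K})%VS -> tau sqrtd = - sqrtd -> quadratic tau.
Proof.
move=> d_sqf d_gt1 sqrtd2 K_gen tauN; split.
- move=> x; exact: (tauK sqrtd2 K_gen tauN).
- exact: OK_norm d_sqf d_gt1 sqrtd2 K_gen tau tauN.
- move=> x y; exact: (OK_powers d_sqf d_gt1 sqrtd2 K_gen tauN).
- move=> x; have [a [b ->]] := quad_coord sqrtd2 K_gen x.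
  have Osd : OK sqrtd.
    apply: (@trace_norm_OK _ tau _ 0 (- d%:Z)); first by rewrite tauN subrr.
    by rewrite tauN mulrN -expr2 sqrtd2 rmorphN.
  have OKden (c : rat) : OK ((denq c)%:~R * c%:A : K).
    by rewrite -in_alg_int -in_algM mulrC -numqE in_alg_int; exact: OK_int.
  exists (`|denq a| * `|denq b|)%N; first by rewrite muln_eq0 !absz_eq0 !negb_or !denq_eq0.
  have den_nat (c : rat) : (`|denq c|%N%:R : K) = (denq c)%:~R.
    by rewrite -[in RHS](gez0_abs (denq_ge0 c)).
  rewrite natrM !den_nat mulrDr mulrAC mulrA; apply: OKD.
    by apply: OKM; [exact: OKden|exact: OK_int].
  by rewrite -[_ * _ * b%:A]mulrA -mulrA; apply: OKM; [exact: OK_int|apply: OKM].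
exact: OK_basis d_sqf d_gt1 sqrtd2 K_gen tau tauN.
Qed.

Section Principal.
Variable K : splittingFieldType rat.
Implicit Types a b x y : K.

Lemma principalP a x : principal a x <-> exists2 y, OK y & x = a * y.
Proof. by split=> [[y Oy <-]|[y Oy ->]]; exists y. Qed.

Lemma principal_OK a x : OK a -> principal a x -> OK x.
Proof. by move=> Oa /principalP[y Oy ->]; exact: OKM. Qed.

Lemma principal0 a : principal a 0.
Proof. by apply/principalP; exists 0; rewrite ?mulr0 //; exact: OK0. Qed.

Lemma principalD a x y : principal a x -> principal a y -> principal a (x + y).
Proof.
move=> /principalP[s Os ->] /principalP[t Ot ->].
by apply/principalP; exists (s + t); rewrite ?mulrDr //; exact: OKD.
Qed.

Lemma principalN a x : principal a x -> principal a (- x).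
Proof.
by move=> /principalP[s Os ->]; apply/principalP; exists (- s); rewrite ?mulrN //; exact: OKN.
Qed.

Lemma principalB a x y : principal a x -> principal a y -> principal a (x - y).
Proof. by move=> ax ay; apply: principalD => //; exact: principalN. Qed.

Lemma principalMl a x y : OK x -> principal a y -> principal a (x * y).
Proof.
move=> Ox /principalP[t Ot ->]; apply/principalP.
by exists (x * t); rewrite 1?mulrCA //; exact: OKM.
Qed.

Lemma principalMr a x y : OK y -> principal a x -> principal a (x * y).
Proof. by rewrite mulrC; exact: principalMl. Qed.

Lemma principalX_le a m n x : OK a -> (m <= n)%N ->
  principal (a ^+ n) x -> principal (a ^+ m) x.
Proof.
move=> Oa mn /principalP[t Ot ->]; apply/principalP.
exists (a ^+ (n - m) * t); first exact: OKM (OKX _ Oa) Ot.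
by rewrite mulrA -exprD subnKC.
Qed.

End Principal.

Section Valuation.
Variables (K : splittingFieldType rat) (tau : {rmorphism K -> K}).
Hypothesis quadK : quadratic tau.
Variable p : nat.
Hypothesis p_prime : prime p.
Hypothesis p_inert : prime_ideal (principal (p%:R : K)).
Implicit Types a b x y z : K.

Local Notation pK := (p%:R : K).
Local Notation unitp := (@OK K `\` principal pK).

Lemma pK_neq0 : pK != 0.
Proof. by rewrite K_natr_eq0 -lt0n prime_gt0. Qed.

Lemma unitp_OK x : unitp x -> OK x. Proof. by case. Qed.

Lemma unitp_neq0 x : unitp x -> x != 0.
Proof. by case=> _ Px; apply/eqP => x0; apply: Px; rewrite x0; exact: principal0. Qed.

Lemma unitp1 : unitp 1.
Proof.
split; first exact: OK1.
move=> P1; case: p_inert => _ + _; apply; apply/seteqP; split=> x.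
  by apply: principal_OK; exact: OK_nat.
by move=> Ox; rewrite -[x]mulr1; exact: principalMl.
Qed.

Lemma unitpM x y : unitp x -> unitp y -> unitp (x * y).
Proof.
move=> [Ox Px] [Oy Py]; split; first exact: OKM.
by case: p_inert => _ _ prim /prim[].
Qed.

Lemma principal_tau n x : principal (n%:R : K) x -> principal (n%:R : K) (tau x).
Proof.
move=> /principalP[t Ot ->]; apply/principalP; exists (tau t); first exact: OK_rmorph.
by rewrite rmorphM rmorph_nat.
Qed.

(** Conjugation preserves [p O] and [p] is prime in [O], so the norm [n] of [x] is prime to [p].
    From [u n + v p ^ k = 1] the inverse is [u] times the conjugate of [x]. *)
Lemma unitp_inv x k : unitp x -> exists2 y, OK y & principal (pK ^+ k) (x * y - 1).
Proof.
move=> [Ox Px]; have [n nE] := norm_int quadK Ox.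
have cop : coprime `|n| p.
  rewrite coprime_sym prime_coprime //; apply/negP => /dvdnP[m mE].
  have : principal pK (x * tau x).
    apply/principalP; exists (sgz n * m)%:~R; first exact: OK_int.
    have nm : n = p%:Z * (sgz n * m) by rewrite mulrCA -PoszM mulnC -mE -intEsg.
    by rewrite nE {1}nm rmorphM.
  case: p_inert => _ _ prim /prim[] //; first exact: OK_rmorph.
  by move/principal_tau; rewrite (conjK quadK).
have /coprimezP[[u v] /= uv] : coprimez n (p%:Z ^+ k).
  by rewrite /coprimez -[gcdz _ _]/(gcdn _ _)%:Z abszX eqz_nat; apply: coprimeXr.
exists (tau x * u%:~R); first by apply: OKM; [exact: OK_rmorph|exact: OK_int].
apply/principalP; exists (- v%:~R); first by apply: OKN; exact: OK_int.
have := congr1 (intr : int -> K) uv; rewrite rmorphD !rmorphM rmorphXn /= => uvK.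
have {}uvK : u%:~R * n%:~R + v%:~R * pK ^+ k = 1 by [].
by rewrite mulrA nE -[X in _ - X]uvK; ring.
Qed.

(** The graph of [nu]: as a relation it is additive before existence and uniqueness of the valuation
    are known. *)
Definition hasv x (n : int) := exists a b, [/\ unitp a, unitp b & x = pK ^ n * (a / b)].

Lemma hasv_neq0 x n : hasv x n -> x != 0.
Proof.
move=> [a [b [/unitp_neq0 a0 /unitp_neq0 b0 ->]]].
by rewrite !mulf_neq0 ?invr_eq0 // expfz_neq0 // pK_neq0.
Qed.

Lemma hasvM x y m n : hasv x m -> hasv y n -> hasv (x * y) (m + n).
Proof.
move=> [a [b [ua ub ->]]] [a' [b' [ua' ub' ->]]].
exists (a * a'), (b * b'); split; try exact: unitpM.
by rewrite expfzDr ?pK_neq0 // invfM; ring.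
Qed.

Lemma hasvV x n : hasv x n -> hasv x^-1 (- n).
Proof.
move=> [a [b [ua ub ->]]]; exists b, a; split => //.
by rewrite !invfM invrK invr_expz [b / a]mulrC.
Qed.

Lemma hasv_unitp x : unitp x -> hasv x 0.
Proof. by move=> ux; exists x, 1; split=> //; [exact: unitp1|rewrite expr0z mul1r divr1]. Qed.

Lemma hasv_p (n : int) : hasv (pK ^ n) n.
Proof. by exists 1, 1; split; [exact: unitp1|exact: unitp1|rewrite divr1 mulr1]. Qed.

(** Descent on the absolute value of the norm, which loses a factor [p ^ 2] with each division by
    [p]. *)
Lemma hasv_OK x : OK x -> x != 0 -> exists n : nat, hasv x n%:Z.
Proof.
move=> Ox x0; have [m mE] := norm_int quadK Ox.
have [k] := ubnP `|m|%N; elim: k x m Ox x0 mE => // k IH x m Ox x0 mE mk.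
have [/principalP[y Oy xE]|Px] := pselect (principal pK x); last first.
  by exists 0%N; apply: hasv_unitp.
have y0 : y != 0 by apply: contraNneq x0 => y0; rewrite xE y0 mulr0.
have [m' mE'] := norm_int quadK Oy.
have m'0 : m' != 0.
  by apply: contraNneq y0 => m0; move/eqP: mE'; rewrite m0 mulf_eq0 fmorph_eq0 orbb.
have mm : m = p%:Z ^+ 2 * m'.
  by apply: (@K_intr_inj K); rewrite -mE xE rmorphM rmorph_nat rmorphM rmorphXn /= -mE'; ring.
have [] := IH y m' Oy y0 mE'.
  move: mk; rewrite mm abszM abszX /= ltnS; apply: leq_trans.
  rewrite -[ltnLHS]mul1n ltn_pmul2r ?absz_gt0 //.
  by rewrite -{1}(expn0 p) ltn_exp2l // prime_gt1.
move=> n hn; exists n.+1; rewrite xE -[n.+1]add1n PoszD.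
by apply: hasvM => //; exact: (hasv_p 1).
Qed.

Lemma hasv_ex x : x != 0 -> exists n : int, hasv x n.
Proof.
move=> x0; have [k k0 Okx] := OK_denom quadK x.
have k0' : (k%:R : K) != 0 by rewrite K_natr_eq0.
have [|n hn] := hasv_OK Okx; first exact: mulf_neq0.
have [m hm] := hasv_OK (OK_nat K k) k0'.
exists (n%:Z - m%:Z); rewrite -[x](mulKf k0') mulrC.
by apply: hasvM => //; exact: hasvV.
Qed.


(** In [x * b = p ^ n * a] the prime [p] does not divide [b], so its [n] factors pass to [x] one at
    a time; a further factor would divide [a]. *)
Lemma principal_hasv x (n k : nat) : OK x -> hasv x n%:Z ->
  principal (pK ^+ k) x <-> (k <= n)%N.
Proof.
move=> Ox [a [b [[Oa Pa] ub xE]]]; have b0 := unitp_neq0 ub; split; last first.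
  move=> kn; suff : principal (pK ^+ n) x by apply: principalX_le => //; exact: OK_nat.
  have xb : x * b = pK ^+ n * a by rewrite xE mulrA divfK.
  elim: n {xE kn} x Ox xb => [|n IH] x Ox xb.
    by apply/principalP; exists x; rewrite // expr0 mul1r.
  case: p_inert => _ _ prim; case: (prim x b) => //; first exact: unitp_OK.
  + rewrite xb exprS -mulrA; apply/principalP; exists (pK ^+ n * a) => //.
    by apply: OKM => //; apply: OKX; exact: OK_nat.
  + move=> /principalP[y Oy yE]; rewrite yE.
    have /principalP[z Oz zE] : principal (pK ^+ n) y.
      apply: IH => //; apply: (mulfI pK_neq0); by rewrite mulrA -yE xb exprS mulrA.
    by apply/principalP; exists z => //; rewrite zE exprS mulrA.
  + by case: ub.
move=> /principalP[y Oy yE]; rewrite leqNgt; apply/negP => nk; apply: Pa.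
apply/principalP; exists (pK ^+ (k - n.+1) * (y * b)).
  by apply: OKM; [apply: OKX; exact: OK_nat|apply: OKM; [|exact: unitp_OK]].
have : x * b = pK ^+ n * a by rewrite xE mulrA divfK.
have pn0 : pK ^+ n != 0 by rewrite expf_neq0 // pK_neq0.
rewrite yE => yb; apply: (mulfI pn0); rewrite -yb.
rewrite [RHS]mulrA -exprSr [RHS]mulrA -exprD subnKC //; ring.
Qed.

Lemma hasv_uniq x m n : hasv x m -> hasv x n -> m = n.
Proof.
move=> hm hn; have : hasv 1 (m - n).
  by rewrite -(mulfV (hasv_neq0 hm)); apply: hasvM => //; exact: hasvV.
suff main l : hasv 1 l -> l <= 0.
  move=> h; have := hasvV h; rewrite invr1 => /main; have := main _ h; lia.
case: l => // l /(principal_hasv l (OK1 K)) [_ /(_ (leqnn l))].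
case: l => // l P1 ; case: unitp1 => _ []; move: P1.
by rewrite -{2}[pK]expr1; apply: principalX_le => //; exact: OK_nat.
Qed.

Lemma nuE x n : hasv x n -> nu p x = n.
Proof.
move=> hn; rewrite /nu; case: xgetP => [m _ hm|/(_ n)]; last by case.
exact: hasv_uniq hm hn.
Qed.

(** The localization of [O] at [p]. Unlike [hasv] it admits 0, so it is closed under sums. *)
Definition vge0 x := exists a b, [/\ OK a, unitp b & x = a / b].

Lemma vge0_OK x : OK x -> vge0 x.
Proof. by move=> Ox; exists x, 1; split; [|exact: unitp1|rewrite divr1]. Qed.

Lemma vge0_hasv0 x : hasv x 0 -> vge0 x.
Proof. by move=> [a [b [[Oa _] ub ->]]]; exists a, b; split; rewrite // expr0z mul1r. Qed.

Lemma vge0D x y : vge0 x -> vge0 y -> vge0 (x + y).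
Proof.
move=> [a [b [Oa ub ->]]] [a' [b' [Oa' ub' ->]]].
exists (a * b' + a' * b), (b * b'); split; [|exact: unitpM|].
  by apply: OKD; apply: OKM => //; exact: unitp_OK.
by field; rewrite (unitp_neq0 ub) (unitp_neq0 ub').
Qed.

Lemma vge0M x y : vge0 x -> vge0 y -> vge0 (x * y).
Proof.
move=> [a [b [Oa ub ->]]] [a' [b' [Oa' ub' ->]]].
exists (a * a'), (b * b'); split; [exact: OKM|exact: unitpM|].
by rewrite invfM; ring.
Qed.

Lemma vge0_dich x : vge0 x -> hasv x 0 \/ vge0 (x / pK).
Proof.
move=> [a [b [Oa ub ->]]]; have [/principalP[y Oy yE]|Pa] := pselect (principal pK a).
  right; exists y, b; split => //; by rewrite yE; field; rewrite pK_neq0 (unitp_neq0 ub).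
left; exists a, b; split => //; by rewrite expr0z mul1r.
Qed.

Lemma hasv0_vge0 x : hasv x 0 -> ~ vge0 (x / pK).
Proof.
move=> [a [b [[Oa Pa] ub ->]]] [a' [b' [Oa' ub' E]]].
have [_] : unitp (a * b') by apply: unitpM.
apply; apply/principalP; exists (a' * b); first by apply: OKM => //; exact: unitp_OK.
have b0 := unitp_neq0 ub; have b'0 := unitp_neq0 ub'; have p0 := pK_neq0.
apply: (mulIf (invr_neq0 b0)); apply: (mulIf (invr_neq0 b'0)); apply: (mulIf (invr_neq0 p0)).
move: E; rewrite expr0z mul1r => E.
have -> : a * b' / b / b' / pK = a / b / pK by field; rewrite b0 b'0 p0.
by rewrite E; field; rewrite b0 b'0 p0.
Qed.

End Valuation.

(** * Fractional ideals and ray classes *)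

Section Ideals.
Variable K : splittingFieldType rat.
Implicit Types (a b x y : K) (I J : set K).

(** Multiplication by a principal ideal, by [ideal_mul_principal]; it removes products of ideals
    from the count. *)
Definition scale a I : set K := [set a * x | x in I].

Lemma scale1 I : scale 1 I = I.
Proof.
apply/seteqP; split=> x; first by case=> y Iy <-; rewrite mul1r.
by move=> Ix; exists x; rewrite ?mul1r.
Qed.

Lemma scaleM a b I : scale a (scale b I) = scale (a * b) I.
Proof.
apply/seteqP; split=> x.
  by case=> _ [y Iy <-] <-; exists y; rewrite ?mulrA.
by case=> y Iy <-; exists (b * y); rewrite ?mulrA //; exists y.
Qed.

End Ideals.

Section LocalIdeals.
Variables (K : splittingFieldType rat) (tau : {rmorphism K -> K}).
Hypothesis quadK : quadratic tau.
Variable p : nat.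
Hypothesis p_prime : prime p.
Hypothesis p_inert : prime_ideal (principal (p%:R : K)).
Implicit Types (a b x y : K) (I J : set K).

Local Notation pK := (p%:R : K).
Local Notation unitp := (@OK K `\` principal pK).
Local Notation hasv := (hasv p).
Local Notation vge0 := (vge0 p).

Lemma fractional_scale a I : a != 0 -> fractional_ideal I -> fractional_ideal (scale a I).
Proof.
move=> a0 [[x Ix x0] ID IM [c [Oc c0 Ic]]]; split.
- by exists (a * x); [exists x|rewrite mulf_neq0].
- by move=> _ _ [y Iy <-] [z Iz <-]; exists (y + z); [exact: ID|rewrite mulrDr].
- by move=> b _ Ob [y Iy <-]; exists (b * y); [exact: IM|rewrite mulrCA].
have [D D0 ODa] := OK_denom quadK a.
have OD : OK (D%:R : K) by exact: OK_nat.
exists (D%:R * c); split; [exact: OKM|by rewrite mulf_neq0 // K_natr_eq0|].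
move=> _ [y Iy <-]; rewrite mulrACA; apply: OKM => //; exact: Ic.
Qed.

Lemma fractional_principal a : a != 0 -> fractional_ideal (principal a).
Proof.
(* [principal a] is convertible to [scale a (@OK K)]. *)
move=> a0; apply: fractional_scale => //; split.
- by exists 1; [exact: OK1|exact: oner_neq0].
- exact: OKD.
- exact: OKM.
- by exists 1; split; [exact: OK1|exact: oner_neq0|move=> x; rewrite mul1r].
Qed.

Lemma ideal_mul_principal I a : fractional_ideal I -> ideal_mul I (principal a) = scale a I.
Proof.
case=> [[x0 Ix0 _] ID IM _].
have I0 : I 0 by rewrite -[0](mul0r x0); apply: IM => //; exact: OK0.
apply/seteqP; split=> x.
  case=> s [sI ->]; rewrite big_seq; elim/big_ind: _.
  - by exists 0; rewrite ?mulr0.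
  - by move=> _ _ [y Iy <-] [z Iz <-]; exists (y + z); [exact: ID|rewrite mulrDr].
  - move=> [y z] /sI /= [Iy /principalP[t Ot ->]]; exists (t * y); first exact: IM.
    by rewrite mulrA mulrC.
case=> y Iy <-; exists [:: (y, a)]; split.
  move=> _ /[!inE] /eqP -> /=; split=> //.
  by apply/principalP; exists 1; rewrite ?mulr1 //; exact: OK1.
by rewrite big_seq1 mulrC.
Qed.

Lemma pX_OK k : OK (pK ^+ k). Proof. by apply: OKX; exact: OK_nat. Qed.

Lemma unitp_ndvd k x y : (0 < k)%N -> unitp x -> OK y -> principal (pK ^+ k) (x - y) -> unitp y.
Proof.
move=> k0 [Ox Px] Oy xy; split=> // Py; apply: Px.
rewrite -[x](subrK y); apply: principalD => //; rewrite -[pK]expr1.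
by apply: principalX_le xy => //; exact: OK_nat.
Qed.

(** An element of [I] outside [p O] is invertible mod [p ^ k], which writes 1 as a sum; the
    right-hand side no longer depends on [k]. *)
Lemma coprime_idealP k I : (0 < k)%N -> integral_ideal I ->
  coprime_ideal I (principal (pK ^+ k)) <-> exists2 b, I b & unitp b.
Proof.
move=> k0 [[_ ID IM _] IO]; split=> [cop|[b Ib ub]].
  have : ideal_add I (principal (pK ^+ k)) 1 by rewrite [ideal_add _ _]cop; exact: OK1.
  move=> [x [y [Ix yp E]]]; exists x => //.
  apply: (@unitp_ndvd k 1) => //; [exact: unitp1|exact: IO|].
  by have -> : 1 - x = y by rewrite E addrAC subrr add0r.
have [b' Ob' bb'] := unitp_inv quadK p_prime p_inert k ub.
apply/seteqP; split=> z.
  case=> x [y [Ix py ->]]; apply: OKD; first exact: IO.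
  exact: principal_OK (pX_OK k) py.
move=> Oz; exists (z * b' * b), (- (z * (b * b' - 1))); split.
- by apply: IM => //; exact: OKM.
- by apply: principalN; exact: principalMl.
- by ring.
Qed.

Lemma principal_integral b : OK b -> b != 0 -> integral_ideal (principal b).
Proof. by move=> Ob b0; split; [exact: fractional_principal|move=> x; exact: principal_OK]. Qed.

Lemma coprime_principal k b : (0 < k)%N -> OK b -> b != 0 ->
  coprime_ideal (principal b) (principal (pK ^+ k)) <-> unitp b.
Proof.
move=> k0 Ob b0; rewrite coprime_idealP //; last exact: principal_integral.
split=> [[_ /principalP[y Oy ->] [_ Py]]|ub].
  by split=> // Pb; apply: Py; apply: principalMr.
by exists b => //; apply/principalP; exists 1; rewrite ?mulr1 //; exact: OK1.
Qed.

Lemma hasv0_unitp x : OK x -> hasv x 0 -> unitp x.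
Proof.
move=> Ox h; split=> //; rewrite -[pK]expr1 => Px.
by have := (principal_hasv p_prime p_inert 1 Ox h).1 Px.
Qed.

(** The only possible denominator of [x] is a power of [p], and [x] has no pole at [p]. *)
Lemma vge0_pX_OK x n : vge0 x -> OK (pK ^+ n * x) -> OK x.
Proof.
move=> [a [b [Oa ub xE]]] Op; have b0 := unitp_neq0 ub.
have [b' Ob' bb'] := unitp_inv quadK p_prime p_inert n ub.
have : principal (pK ^+ n) (pK ^+ n * x).
  have -> : pK ^+ n * x = pK ^+ n * (a * b') - (pK ^+ n * x) * (b * b' - 1).
    by rewrite xE; field.
  apply: principalB; last exact: principalMl.
  by apply/principalP; exists (a * b') => //; exact: OKM.
case/principalP => y Oy /(mulfI _) -> //.
by rewrite expf_neq0 // (pK_neq0 K p_prime).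
Qed.

(** Given [I B = A], an element of [B] outside [p O] serves as denominator for all of [I]; if no
    element of [I] had valuation 0, all of [A] would be locally divisible by [p]. Conversely, write
    a common denominator as [c = p ^ n * (a / b)]: since [I] has no pole at [p], the part [a] prime
    to [p] already clears denominators, so [A = a I] and [B = (a)]. *)
Lemma prime_toP k I : (0 < k)%N ->
  prime_to (principal (pK ^+ k)) I <->
  [/\ fractional_ideal I, forall x, I x -> vge0 x & exists2 x, I x & hasv x 0].
Proof.
move=> k0; split.
  case=> fI [A [B [iA iB /(coprime_idealP k0 iA)[a Aa ua] /(coprime_idealP k0 iB)[b Bb ub] IBA]]].
  split=> // [x Ix|].
    exists (x * b), b; split => //; last by rewrite mulfK // (unitp_neq0 ub).
    case: iA => _; apply; rewrite -IBA; exists [:: (x, b)].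
    by split=> [_ /[!inE] /eqP -> //|]; rewrite big_seq1.
  move: Aa; rewrite -IBA => -[s [sI aE]].
  apply: contrapT => noI.
  have Ip x : I x -> vge0 x -> vge0 (x / pK).
    by move=> Ix /(vge0_dich p_prime) [] // hx; case: noI; exists x.
  have : vge0 (a / pK).
    rewrite aE mulr_suml big_seq; elim/big_ind: _.
    - by apply: vge0_OK => //; exact: OK0.
    - by move=> *; apply: vge0D.
    - move=> [x y] xys; have [/= Ix By] := sI _ xys; rewrite mulrAC; apply: vge0M => //.
        apply: Ip => //; exists (x * b), b; split => //; last by rewrite mulfK // (unitp_neq0 ub).
        case: iA => _; apply; rewrite -IBA; exists [:: (x, b)].
        by split=> [_ /[!inE] /eqP -> //|]; rewrite big_seq1.
      by apply: vge0_OK => //; case: iB => _; exact.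
  by apply: (hasv0_vge0 p_prime p_inert); apply: hasv_unitp.
case=> fI Iv [x Ix hx]; split=> //.
have [_ ID IM [c [Oc c0 Ic]]] := fI.
have [n [a [b [ua ub cE]]]] := hasv_OK quadK p_prime p_inert Oc c0.
have b0 := unitp_neq0 ub; have a0 := unitp_neq0 ua.
have Oa : OK a by case: ua.
have iA : integral_ideal (scale a I).
  split; first exact: fractional_scale.
  move=> _ [y Iy <-]; apply: (@vge0_pX_OK _ n).
    by apply: vge0M => //; [apply: vge0_OK|exact: Iv].
  have -> : pK ^+ n * (a * y) = b * (c * y) by rewrite cE -exprnP; field.
  by apply: OKM; [case: ub|exact: Ic].
exists (scale a I), (principal a); split=> //.
- exact: principal_integral.
- apply/coprime_idealP => //; exists (a * x); first by exists x.
  apply: hasv0_unitp; first by case: iA => _; apply; exists x.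
  by rewrite -[0]addr0; apply: hasvM => //; exact: hasv_unitp.
- exact/coprime_principal.
- exact: ideal_mul_principal.
Qed.

Lemma coprime_OK I : integral_ideal I -> coprime_ideal I (@OK K).
Proof.
move=> [[[x0 Ix0 _] _ IM _] IO]; apply/seteqP; split=> z.
  by case=> x [y [Ix Oy ->]]; apply: OKD => //; exact: IO.
move=> Oz; exists 0, z; split; rewrite ?add0r //.
by rewrite -[0](mul0r x0); apply: IM => //; exact: OK0.
Qed.

Lemma prime_to_OK I : prime_to (@OK K) I <-> fractional_ideal I.
Proof.
split=> [[]//|fI]; split=> //; have [_ _ _ [c [Oc c0 Ic]]] := fI.
have iA : integral_ideal (scale c I).
  split; first exact: fractional_scale.
  by move=> _ [y Iy <-]; exact: Ic.
exists (scale c I), (principal c); split=> //.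
- exact: principal_integral.
- exact: coprime_OK.
- by apply: coprime_OK; exact: principal_integral.
- exact: ideal_mul_principal.
Qed.

Lemma cong1P k a : (0 < k)%N -> cong1 (principal (pK ^+ k)) a <->
  exists b c, [/\ unitp b, unitp c, principal (pK ^+ k) (b - c) & a = b / c].
Proof.
move=> k0; split=> [[b [c [[Ob b0] [Oc c0] [cb cc] bc aE]]]|[b [c [ub uc bc aE]]]].
  by exists b, c; split=> //; apply/(@coprime_principal k).
have [[Ob b0] [Oc c0]] : (OK b /\ b != 0) /\ (OK c /\ c != 0).
  split; split; [exact: unitp_OK ub|exact: unitp_neq0 ub| |exact: unitp_neq0 uc].
  exact: unitp_OK uc.
by exists b, c; split=> //; split; apply/coprime_principal.
Qed.

(** For modulus 1 the congruence is void; clearing the denominator of [a] writes it as a quotient of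
    integers. *)
Lemma cong1_OK a : cong1 (@OK K) a <-> a != 0.
Proof.
split=> [[b [c [[_ b0] [_ c0] _ _ ->]]]|a0]; first by rewrite mulf_neq0 ?invr_eq0.
have [n n0 On] := OK_denom quadK a; have n0' : (n%:R : K) != 0 by rewrite K_natr_eq0.
have na0 : n%:R * a != 0 by rewrite mulf_neq0.
exists (n%:R * a), n%:R; split=> //; first by split=> //; exact: OK_nat.
- by split; apply: coprime_OK; apply: principal_integral => //; exact: OK_nat.
- by apply: OKB => //; exact: OK_nat.
- by rewrite mulrC mulKf.
Qed.

Lemma cong1_1 k : cong1 (principal (pK ^+ k)) 1.
Proof.
have H : OK (1 : K) /\ (1 : K) != 0 by split; [exact: OK1|exact: oner_neq0].
have C : coprime_ideal (principal (1 : K)) (principal (pK ^+ k)).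
  apply/seteqP; split=> z.
    case=> x [y [/principalP[t Ot ->] py ->]]; apply: OKD; first by rewrite mul1r.
    exact: principal_OK (pX_OK k) py.
  move=> Oz; exists z, 0; split; [|exact: principal0|by rewrite addr0].
  by apply/principalP; exists z; rewrite ?mul1r.
by exists 1, 1; split; rewrite ?divr1 // subrr; exact: principal0.
Qed.

Lemma cong1M k a b : (0 < k)%N -> cong1 (principal (pK ^+ k)) a ->
  cong1 (principal (pK ^+ k)) b -> cong1 (principal (pK ^+ k)) (a * b).
Proof.
move=> k0 /(cong1P _ k0)[s [t [us ut st ->]]] /(cong1P _ k0)[s' [t' [us' ut' st' ->]]].
apply/cong1P => //; exists (s * s'), (t * t'); split; try exact: unitpM.
  have -> : s * s' - t * t' = s * (s' - t') + t' * (s - t) by ring.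
  by apply: principalD; apply: principalMl => //; [exact: unitp_OK us|exact: unitp_OK ut'].
by rewrite invfM; ring.
Qed.

Lemma cong1V k a : cong1 (principal (pK ^+ k)) a -> cong1 (principal (pK ^+ k)) a^-1.
Proof.
move=> [s [t [s0 t0 [cs ct] st ->]]]; exists t, s; split=> //.
  by rewrite -opprB; exact: principalN.
by rewrite invfM invrK mulrC.
Qed.

Lemma stabilizer_unit a I : a != 0 -> fractional_ideal I -> scale a I = I -> units a.
Proof.
move=> a0 [[x Ix x0] _ _ [c [Oc c0 Ic]]] aI.
have Ia n : I (a ^+ n * x).
  elim: n => [|n IH]; first by rewrite expr0 mul1r.
  by rewrite exprS -mulrA -aI; exists (a ^+ n * x).
have Iva n : I (a^-1 ^+ n * x).
  elim: n => [|n IH]; first by rewrite expr0 mul1r.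
  have : scale a I (a^-1 ^+ n * x) by rewrite aI.
  by case=> y Iy yE; rewrite exprS -mulrA -yE mulKf.
split; last exists a^-1; last by rewrite mulfV.
  apply: (@OK_of_powers _ _ quadK a (c * x)); first exact: mulf_neq0.
  by move=> n; rewrite -mulrA [x * _]mulrC; apply: Ic; exact: Ia.
apply: (@OK_of_powers _ _ quadK _ (c * x)); first exact: mulf_neq0.
by move=> n; rewrite -mulrA [x * _]mulrC; apply: Ic; exact: Iva.
Qed.

Lemma unit_stabilizes a I : units a -> fractional_ideal I -> scale a I = I.
Proof.
move=> [Oa [b Ob ab]] [_ _ IM _]; apply/seteqP; split=> x.
  by case=> y Iy <-; exact: IM.
by move=> Ix; exists (b * x); [exact: IM|rewrite mulrA ab mul1r].
Qed.

Lemma hasv_vge0 x (n : nat) : hasv x n%:Z -> vge0 x.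
Proof.
move=> [a [b [[Oa _] ub ->]]]; exists (pK ^+ n * a), b; split=> //; last by rewrite mulrA.
by apply: OKM => //; exact: pX_OK.
Qed.

Lemma scale_prime_to k I : (0 < k)%N -> fractional_ideal I ->
  exists n : int, prime_to (principal (pK ^+ k)) (scale (pK ^ n) I).
Proof.
move=> k0 fI; have [[x Ix x0] _ _ [c [Oc c0 Ic]]] := fI.
have [l hl] := hasv_OK quadK p_prime p_inert Oc c0.
(* [c I] is integral, so its valuations are natural numbers with a minimum [m]. The minimum on [I]
   is [m - l], where [l] is the valuation of [c]. *)
have exm : exists m : nat, `[< exists2 y, I y & hasv (c * y) m%:Z >].
  have [m hm] := hasv_OK quadK p_prime p_inert (Ic _ Ix) (mulf_neq0 c0 x0).
  by exists m; apply/asboolP; exists x.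
case: (ex_minnP exm) => m /asboolP[y Iy hy] mmin.
exists (l%:Z - m%:Z); apply/prime_toP => //.
have hs z (j : int) : hasv (c * z) j -> hasv (pK ^ (l%:Z - m%:Z) * z) (j - m%:Z).
  move=> hz; have -> : pK ^ (l%:Z - m%:Z) * z = pK ^ (l%:Z - m%:Z) * (c^-1 * (c * z)).
    by rewrite mulKf.
  have -> : j - m%:Z = (l%:Z - m%:Z) + (- l%:Z + j) by ring.
  apply: hasvM => //; first exact: hasv_p.
  by apply: hasvM => //; exact: hasvV.
split.
- by apply: fractional_scale => //; rewrite expfz_neq0 // (pK_neq0 K p_prime).
- move=> _ [z Iz <-]; have [->|z0] := eqVneq z 0.
    by rewrite mulr0; apply: vge0_OK => //; exact: OK0.
  have [j hj] := hasv_OK quadK p_prime p_inert (Ic _ Iz) (mulf_neq0 c0 z0).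
  have mj : (m <= j)%N by apply: mmin; apply/asboolP; exists z.
  have := hs _ _ hj; rewrite (subzn mj); exact: hasv_vge0.
- by exists (pK ^ (l%:Z - m%:Z) * y); [exists y|rewrite -[0](subrr m%:Z); exact: hs].
Qed.

Lemma vge0_hasv_ge0 x n : vge0 x -> hasv x n -> 0 <= n.
Proof.
move=> [a [b [Oa ub xE]]] hx; have b0 := unitp_neq0 ub.
have aE : a = x * b by rewrite xE divfK.
have a0 : a != 0 by rewrite aE mulf_neq0 // (hasv_neq0 p_prime hx).
have [m hm] := hasv_OK quadK p_prime p_inert Oa a0.
suff -> : n = m%:Z by [].
apply: (hasv_uniq p_prime p_inert _ hm); rewrite aE -[n]addr0.
by apply: hasvM => //; exact: hasv_unitp.
Qed.

Lemma prime_to_scale k a I : (0 < k)%N -> a != 0 -> prime_to (principal (pK ^+ k)) I ->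
  prime_to (principal (pK ^+ k)) (scale a I) <-> hasv a 0.
Proof.
move=> k0 a0 /(prime_toP _ k0)[fI Iv [x Ix hx]].
split=> [|ha].
  have [n hn] := hasv_ex quadK p_prime p_inert a0.
  move=> /(prime_toP _ k0)[_ aIv [_ [y Iy <-] hy]].
  have hax : hasv (a * x) n by rewrite -[n]addr0; apply: hasvM.
  have n0 : 0 <= n by apply: vge0_hasv_ge0 hax; apply: aIv; exists x.
  have hy' : hasv y (- n).
    rewrite -[y](mulKf a0) -[- n]addr0; apply: hasvM => //; exact: hasvV.
  have nn : 0 <= - n by apply: vge0_hasv_ge0 hy'; exact: Iv.
  by have -> : 0 = n by lia.
apply/prime_toP => //; split; first exact: fractional_scale.
  by move=> _ [y Iy <-]; apply: vge0M => //; [exact: vge0_hasv0|exact: Iv].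
by exists (a * x); [exists x|rewrite -[0]addr0; apply: hasvM].
Qed.

End LocalIdeals.

(** * Counting ray classes over narrow classes *)

Lemma set_card_range (X : finType) (T : choiceType) (g : X -> T) :
  injective g -> set_card (range g) = #|X|.
Proof.
move=> g_inj; rewrite /set_card.
have -> : range g = [set` [fset g x | x in X]%fset].
  apply/seteqP; split=> y /=.
    by case=> x _ <-; apply/imfsetP; exists x.
  by case/imfsetP => x _ ->; exists x.
by rewrite set_fsetK card_imfset //= -cardE.
Qed.

(** Fibers come with enumerations, so [A] is rebuilt as the range of an injection from a finite type
    and its finiteness is not assumed. *)
Lemma set_card_fibers (T T' : choiceType) (A : set T) (f : T -> T') (n : nat) :
  (0 < n)%N ->
  (forall y, (f @` A) y -> exists g : 'I_n -> T, injective g /\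
     range g = A `&` f @^-1` [set y]) ->
  set_card A = (n * set_card (f @` A))%N.
Proof.
(* An infinite image makes [A] infinite as well, and both cardinals take the default value 0. *)
move=> n0 fib; have [finB|infB] := pselect (finite_set (f @` A)); last first.
  have infA : ~ finite_set A by move=> /(finite_image f).
  rewrite /set_card /fset_set; case: pselect => // _; case: pselect => // _.
  by rewrite cardfs0 muln0.
pose F := fset_set (f @` A).
have FP (y : F) : (f @` A) (val y).
  by have := valP y; rewrite in_fset_set // inE.
have [h hP] := choice (fun y : F => fib _ (FP y)).
pose g (yi : F * 'I_n) := h yi.1 yi.2.
have gP yi : A (g yi) /\ f (g yi) = val yi.1.
  have [_ /seteqP[/(_ (g yi)) + _]] := hP yi.1; apply; by exists yi.2.
have g_inj : injective g.
  move=> [y i] [y' i'] E; have [_ fy] := gP (y, i); have [_ fy'] := gP (y', i').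
  have yy' : y = y' by apply: val_inj; rewrite /= -[val y]fy -[val y']fy' E.
  by move: E; rewrite yy' /g /= => /(hP y').1 ->.
have AE : A = range g.
  apply/seteqP; split=> x; last by case=> yi _ <-; have [] := gP yi.
  move=> Ax; have Fx : f x \in F by rewrite in_fset_set // inE; exists x.
  have [_ /seteqP[_ /(_ x)]] := hP [` Fx]%fset; case=> // i _ ix.
  by exists ([` Fx]%fset, i).
by rewrite {1}AE set_card_range // card_prod card_ord mulnC /set_card cardfE.
Qed.

Section ClassNumber.
Variables (R : realType) (K : splittingFieldType rat) (tau : {rmorphism K -> K}).
Hypothesis quadK : quadratic tau.
Variable iota : {rmorphism K -> R}.
Variable p : nat.
Hypothesis p_prime : prime p.
Hypothesis p_inert : prime_ideal (principal (p%:R : K)).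
Implicit Types (a b x y : K) (I J : set K).

Local Notation pK := (p%:R : K).
Local Notation unitp := (@OK K `\` principal pK).
Local Notation hasv := (hasv p).
Local Notation tpos := (@totally_positive R K).

Lemma tpos_neq0 a : tpos a -> a != 0.
Proof. by move=> /(_ iota); apply: contraTneq => ->; rewrite rmorph0 ltxx. Qed.

Lemma tpos1 : tpos 1.
Proof. by move=> sigma; rewrite rmorph1. Qed.

Lemma tposM a b : tpos a -> tpos b -> tpos (a * b).
Proof. by move=> ta tb sigma; rewrite rmorphM mulr_gt0. Qed.

Lemma tposV a : tpos a -> tpos a^-1.
Proof. by move=> ta sigma; rewrite fmorphV invr_gt0. Qed.

Lemma tpos_nat n : (0 < n)%N -> tpos n%:R.
Proof. by move=> n0 sigma; rewrite rmorph_nat ltr0n. Qed.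

Lemma tposXz a (n : int) : tpos a -> tpos (a ^ n).
Proof. by move=> ta sigma; rewrite fmorphXz exprz_gt0. Qed.

(** A coset seen as an orbit under scaling; [ClE] identifies the two. *)
Definition ray_class m I : set (set K) :=
  [set scale a I | a in [set a | tpos a /\ cong1 m a]].

Lemma ClE m : (forall I, prime_to m I -> fractional_ideal I) ->
  Cl R m = [set ray_class m I | I in prime_to m].
Proof.
move=> mfrac; rewrite /Cl /cosets; apply: eq_imagel => I /mfrac fI.
rewrite /ray image_comp; apply: eq_imagel => a _ /=.
exact: ideal_mul_principal.
Qed.

Lemma ray_class_mem m I : cong1 m 1 -> ray_class m I I.
Proof. by move=> m1; exists 1; [split=> //; exact: tpos1|rewrite scale1]. Qed.

Section Ray.
Variable m : set K.
Hypothesis m1 : cong1 m 1.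
Hypothesis mM : forall a b, cong1 m a -> cong1 m b -> cong1 m (a * b).
Hypothesis mV : forall a, cong1 m a -> cong1 m a^-1.

Lemma ray_class_eq I J :
  ray_class m I = ray_class m J <-> exists a, [/\ tpos a, cong1 m a & J = scale a I].
Proof.
split=> [E|[a [ta ma ->]]].
  have := ray_class_mem J m1; rewrite -E => -[a [ta ma] aI].
  by exists a.
apply/seteqP; split=> _ [b [tb mb] <-]; rewrite ?scaleM.
  exists (b / a); last by rewrite scaleM divfK // tpos_neq0.
  by split; [apply: tposM => //; exact: tposV|apply: mM => //; exact: mV].
by exists (b * a) => //; split; [exact: tposM|exact: mM].
Qed.

End Ray.

Lemma cong1_OK_group : [/\ cong1 (@OK K) 1,
  forall a b, cong1 (@OK K) a -> cong1 (@OK K) b -> cong1 (@OK K) (a * b) &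
  forall a, cong1 (@OK K) a -> cong1 (@OK K) a^-1].
Proof.
split; first by apply/(cong1_OK quadK); exact: oner_neq0.
  by move=> a b /(cong1_OK quadK) a0 /(cong1_OK quadK) b0; apply/(cong1_OK quadK)/mulf_neq0.
by move=> a /(cong1_OK quadK) a0; apply/(cong1_OK quadK); rewrite invr_eq0.
Qed.

(** The hypotheses make [rep] a transversal of the totally positive elements of valuation 0 modulo
    ray elements and units. The classes of the [rep i I] then enumerate the fiber over the narrow
    class of [I] without repetition. *)
Lemma class_number_fibers k N (rep : 'I_N -> K) : (0 < k)%N -> (0 < N)%N ->
  (forall i, tpos (rep i) /\ hasv (rep i) 0) ->
  (forall a, tpos a -> hasv a 0 -> exists i b e,
     [/\ tpos b, cong1 (principal (pK ^+ k)) b, units e & a = rep i * b * e]) ->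
  (forall i j b e, tpos b -> cong1 (principal (pK ^+ k)) b -> units e ->
     rep j = rep i * b * e -> i = j) ->
  set_card (Cl R (principal (pK ^+ k))) = (N * set_card (Cl R (@OK K)))%N.
Proof.
move=> k0 N0 repP rep_ex rep_uniq.
set m := principal (pK ^+ k).
have m1 : cong1 m 1 by apply: cong1_1.
have mM a b : cong1 m a -> cong1 m b -> cong1 m (a * b)
  by apply: (cong1M quadK p_prime p_inert k0).
have mV a : cong1 m a -> cong1 m a^-1 by apply: cong1V.
have [o1 oM oV] := cong1_OK_group.
have prime_to_frac I : prime_to m I -> fractional_ideal I.
  by move=> /(prime_toP quadK p_prime p_inert _ k0)[].
rewrite !ClE //; last by move=> I /(prime_to_OK quadK).
(* Taking all totally positive multiples of all members avoids choosing a representative of the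
   class. *)
pose f (C : set (set K)) : set (set K) :=
  [set I | exists J a, [/\ C J, tpos a & I = scale a J]].
have fE I : f (ray_class m I) = ray_class (@OK K) I.
  apply/seteqP; split=> J.
    case=> _ [a [[b [tb mb] <-] ta ->]]; exists (a * b); last by rewrite scaleM.
    by split; [exact: tposM|apply/(cong1_OK quadK); rewrite mulf_neq0 ?tpos_neq0].
  case=> a [ta _] <-; exists I, a; split=> //; exact: ray_class_mem.
have -> : [set ray_class (@OK K) I | I in prime_to (@OK K)] =
    f @` [set ray_class m I | I in prime_to m].
  apply/seteqP; split=> C.
    case=> I /(prime_to_OK quadK) fI <-.
    have [n nI] := scale_prime_to quadK p_prime p_inert k0 fI.
    exists (ray_class m (scale (pK ^ n) I)); first by exists (scale (pK ^ n) I).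
    rewrite fE; apply/esym; apply/ray_class_eq => //.
    have tn : tpos (pK ^ n) by apply: tposXz; apply: tpos_nat; exact: prime_gt0.
    by exists (pK ^ n); split=> //; apply/(cong1_OK quadK); exact: tpos_neq0.
  case=> _ [I mI <-] <-; rewrite fE; exists I => //.
  by apply/(prime_to_OK quadK); exact: prime_to_frac.
apply: set_card_fibers => // _ [_ [I mI <-] <-]; rewrite fE.
have fI := prime_to_frac _ mI.
exists (fun i => ray_class m (scale (rep i) I)); split.
  move=> i j /(ray_class_eq m1 mM mV)[b [tb mb]]; rewrite scaleM => E.
  have [ti _] := repP i; have [tj _] := repP j.
  have i0 := tpos_neq0 ti; have j0 := tpos_neq0 tj; have b0 := tpos_neq0 tb.
  (* This quotient maps [I] onto itself, so it is a unit. *)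
  apply: (rep_uniq i j b (rep j / (b * rep i))) => //; last first.
    by field; rewrite i0 b0.
  apply: (stabilizer_unit quadK _ fI); first by rewrite mulf_neq0 ?invr_eq0 ?mulf_neq0.
  by rewrite mulrC -scaleM E scaleM mulVf ?scale1 // mulf_neq0.
apply/seteqP; split=> C.
  case=> i _ <-; have [ti hi] := repP i; split.
    exists (scale (rep i) I) => //.
    by apply/(prime_to_scale quadK p_prime p_inert k0 (tpos_neq0 ti) mI).
  rewrite /= fE; apply/esym; apply/ray_class_eq => //.
  by exists (rep i); split=> //; apply/(cong1_OK quadK); exact: tpos_neq0.
(* [I] and [J = a I] are both prime to [p], so [a] has valuation 0 and [rep_ex] applies to it. *)
case=> -[J mJ <-]; rewrite /= fE => /esym/(ray_class_eq o1 oM oV)[a [ta _ JE]].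
move: mJ; rewrite JE => /(prime_to_scale quadK p_prime p_inert k0 (tpos_neq0 ta) mI) ha.
have [i [b [e [tb mb ue aE]]]] := rep_ex _ ta ha.
exists i => //; apply/(ray_class_eq m1 mM mV); exists b; split=> //.
by rewrite aE -scaleM (unit_stabilizes ue fI) scaleM [b * _]mulrC.
Qed.

End ClassNumber.

(** * Residues modulo a power of p *)

Lemma iter_order_dvdn (T : finType) (f : T -> T) (x : T) (n : nat) :
  injective f -> (iter n f x == x) = (fingraph.order f x %| n)%N.
Proof.
move=> f_inj; have iterM m : iter (m * fingraph.order f x) f x = x.
  by elim: m => // m IH; rewrite mulSn iterD IH iter_order.
rewrite {1}(divn_eq n (fingraph.order f x)) addnC iterD iterM /dvdn.
have lt := ltn_pmod n (order_gt0 f x).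
apply/eqP/eqP => [it|->] //.
by have := findex_iter lt; rewrite it findex0.
Qed.

Lemma card_dvdn_ord (p k : nat) : (0 < p)%N ->
  #|[set i : 'I_(p ^ k.+1) | (p %| i)%N]%SET| = (p ^ k)%N.
Proof.
move=> p0.
have lt (i : 'I_(p ^ k)) : (p * i < p ^ k.+1)%N by rewrite expnS ltn_pmul2l.
rewrite -[RHS](card_ord (p ^ k)) -cardsT.
rewrite -(card_imset [set: 'I_(p ^ k)]%SET (f := fun i => Ordinal (lt i))); last first.
  by move=> i j [] /eqP; rewrite eqn_pmul2l // => /eqP ij; apply: val_inj.
apply: eq_card => i; rewrite inE; apply/idP/imsetP.
  case/dvdnP => j ij; have ltj : (j < p ^ k)%N.
    by have := ltn_ord i; rewrite ij expnS mulnC ltn_pmul2l.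
  by exists (Ordinal ltj); rewrite ?inE //; apply: val_inj; rewrite /= ij mulnC.
by case=> j _ ->; rewrite /= dvdn_mulr.
Qed.

Section Residues.
Variables (K : splittingFieldType rat) (tau : {rmorphism K -> K}).
Hypothesis quadK : quadratic tau.
Variable w : K.
Hypothesis w_OK : OK w.
Hypothesis w_conj : w != tau w.
Hypothesis w_basis : forall x : K, OK x -> exists a b : int, x = a%:~R + b%:~R * w.
Implicit Types x y : K.

Lemma basis_inj (a b a' b' : int) :
  a%:~R + b%:~R * w = a'%:~R + b'%:~R * w -> a = a' /\ b = b'.
Proof.
move=> E; have := congr1 tau E; rewrite !rmorphD !rmorphM !rmorph_int => E'.
have bb : b = b'.
  apply: (@K_intr_inj K); apply/eqP; rewrite -subr_eq0.
  have : (b%:~R - b'%:~R) * (w - tau w) == 0.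
    have -> : (b%:~R - b'%:~R) * (w - tau w) =
      (a%:~R + b%:~R * w) - (a%:~R + b%:~R * tau w) -
      ((a'%:~R + b'%:~R * w) - (a'%:~R + b'%:~R * tau w)) by ring.
    by rewrite E E' subrr.
  by rewrite mulf_eq0 subr_eq0 [w - _ == 0]subr_eq0 (negPf w_conj) orbF.
split=> //; apply: (@K_intr_inj K); move: E; rewrite bb; exact: addIr.
Qed.

Section Lift.
Variable q : nat.
Hypothesis q_gt0 : (0 < q)%N.

(** The finite type of digit pairs stands for the residue ring mod [q], so no quotient ring is
    built. *)
Definition lift_res (r : 'I_q * 'I_q) : K := r.1%:R + r.2%:R * w.

Lemma lift_res_OK r : OK (lift_res r).
Proof. by apply: OKD; [exact: OK_nat|apply: OKM => //; exact: OK_nat]. Qed.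

Lemma lift_res_inj r r' : principal q%:R (lift_res r - lift_res r') -> r = r'.
Proof.
case: r r' => [i j] [i' j'] /principalP[y /w_basis[a [b ->]]].
rewrite /lift_res /= => E.
have [] : i%:Z = i'%:Z + q%:Z * a /\ j%:Z = j'%:Z + q%:Z * b.
  apply: basis_inj; rewrite !rmorphD !rmorphM /=.
  have -> : (i%:~R + j%:~R * w : K) =
      (i%:R + j%:R * w - (i'%:R + j'%:R * w)) + (i'%:R + j'%:R * w).
    by rewrite subrK.
  by rewrite E -!pmulrn; ring.
have small (s s' : 'I_q) (c : int) : s%:Z = s'%:Z + q%:Z * c -> s = s'.
  move: (ltn_ord s) (ltn_ord s') => lt lt' sE; apply: val_inj => /=; move: sE lt lt'.
  move: (nat_of_ord s) (nat_of_ord s') => m m'.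
  have [?|[->|?]] : c <= -1 \/ c = 0 \/ 1 <= c by lia.
  - by nia.
  - by lia.
  - by nia.
by move=> /small -> /small ->.
Qed.

Lemma lift_res_ex x : OK x -> exists r, principal q%:R (x - lift_res r).
Proof.
move=> /w_basis[a [b ->]].
have q0 : q%:Z != 0 by rewrite -lt0n.
have lt (c : int) : (`|(c %% q)%Z| < q)%N.
  by rewrite -ltz_nat gez0_abs ?modz_ge0 // ltz_pmod // ltz_nat.
exists (Ordinal (lt a), Ordinal (lt b)); apply/principalP.
exists ((a %/ q)%Z%:~R + (b %/ q)%Z%:~R * w).
  by apply: OKD; [exact: OK_int|apply: OKM => //; exact: OK_int].
have E (c : int) : (c%:~R : K) = (c %/ q)%Z%:~R * q%:R + (`|(c %% q)%Z|%N)%:R.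
  rewrite {1}(divz_eq c q) rmorphD rmorphM /=; congr (_ + _).
  by rewrite pmulrn gez0_abs ?modz_ge0.
by rewrite /lift_res /= (E a) (E b); ring.
Qed.

End Lift.

Variable p : nat.
Hypothesis p_prime : prime p.
Hypothesis p_inert : prime_ideal (principal (p%:R : K)).

Local Notation pK := (p%:R : K).
Local Notation unitp := (@OK K `\` principal pK).

Lemma unitp_cancel k x y : unitp x -> OK y -> principal (pK ^+ k) (x * y) -> principal (pK ^+ k) y.
Proof.
move=> ux Oy xy; have [x' Ox' xx'] := unitp_inv quadK p_prime p_inert k ux.
have -> : y = x' * (x * y) - y * (x * x' - 1) by ring.
by apply: principalB; exact: principalMl.
Qed.

Lemma principal_lift_res q (r : 'I_q * 'I_q) :
  principal pK (lift_res r) <-> (p %| r.1)%N /\ (p %| r.2)%N.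
Proof.
split.
  move=> /principalP[y /w_basis[a [b ->]] E].
  have [] : (r.1)%:Z = p%:Z * a /\ (r.2)%:Z = p%:Z * b.
    by apply: basis_inj; rewrite !rmorphM /= -mulrA -mulrDr -E.
  have dv (n : nat) (c : int) : n%:Z = p%:Z * c -> (p %| n)%N.
    move=> nE; have := congr1 absz nE; rewrite abszM absz_nat => ->.
    by rewrite /= dvdn_mulr.
  by move=> /dv -> /dv ->.
rewrite /lift_res => -[/dvdnP[a ->] /dvdnP[b ->]]; apply/principalP.
exists (a%:R + b%:R * w); last by rewrite !natrM; ring.
by apply: OKD; [exact: OK_nat|apply: OKM => //; exact: OK_nat].
Qed.

(** A residue is not invertible exactly when both digits are divisible by [p], which removes
    [p ^ (2 k)] of the [p ^ (2 k + 2)] pairs. *)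
Lemma card_unit_res k :
  #|[set r : 'I_(p ^ k.+1) * 'I_(p ^ k.+1) | `[< unitp (lift_res r) >]]%SET| =
  (p ^ (2 * k) * (p ^ 2 - 1))%N.
Proof.
set S := [set r | _]%SET; have p0 := prime_gt0 p_prime.
pose D := [set i : 'I_(p ^ k.+1) | (p %| i)%N]%SET.
have SC : (~: S = finset.setX D D)%SET.
  apply/setP => r; rewrite !inE; apply/idP/idP => [|/andP[r1 r2]].
    move/asboolPn => nu; apply/andP; apply/principal_lift_res; apply: contrapT => np.
    by apply: nu; split=> //; exact: lift_res_OK.
  by apply/asboolPn => -[_]; apply; apply/principal_lift_res.
have := cardsC S; rewrite SC cardsX card_dvdn_ord // card_prod !card_ord => E.
have -> : #|S| = (p ^ k.+1 * p ^ k.+1 - p ^ k * p ^ k)%N by rewrite -E addnK.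
by rewrite mulnBr muln1 -!expnD; congr (_ ^ _ - _ ^ _)%N; lia.
Qed.

End Residues.

(** * Orbits of invertible residues under the totally positive unit *)

Section RayClassNumber.
Variables (R : realType) (K : splittingFieldType rat) (tau : {rmorphism K -> K}).
Hypothesis quadK : quadratic tau.
Variable iota : {rmorphism K -> R}.
Hypothesis embeddings : forall sigma : {rmorphism K -> R},
  sigma =1 iota \/ sigma =1 iota \o tau.
Variable p : nat.
Hypothesis p_prime : prime p.
Hypothesis p_inert : prime_ideal (principal (p%:R : K)).
Implicit Types (a b x y : K).

Local Notation pK := (p%:R : K).
Local Notation unitp := (@OK K `\` principal pK).
Local Notation tpos := (@totally_positive R K).

Lemma tposP a : tpos a <-> 0 < iota a /\ 0 < iota (tau a).
Proof.
split=> [ta|[a1 a2] sigma]; first by split; [exact: ta|exact: (ta (iota \o tau))].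
by case: (embeddings sigma) => ->.
Qed.

(** Supplies a totally positive element in every residue class mod [q]. *)
Lemma tpos_shift q x : (0 < q)%N -> exists M : nat, tpos (x + M%:R * q%:R).
Proof.
move=> q0; pose b := `|iota x| + `|iota (tau x)|.
have b0 : 0 <= b by rewrite addr_ge0.
exists (Num.bound b); have := archi_boundP b0; set M := Num.bound b => bM.
have MM : M%:R <= M%:R * q%:R :> R by rewrite ler_peMr // ler1n.
apply/tposP; rewrite !rmorphD !rmorphM !rmorph_nat; split.
  have := ler_norm (- iota x); rewrite normrN => h.
  have := normr_ge0 (iota (tau x)); rewrite /b in bM; lra.
have := ler_norm (- iota (tau x)); rewrite normrN => h.
have := normr_ge0 (iota x); rewrite /b in bM; lra.
Qed.

Variable u : K.
Hypothesis u_unit : units u.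
Hypothesis u_tpos : tpos u.
Hypothesis u_gen : forall e, units e -> tpos e -> exists n : int, e = u ^ n.

Lemma units_neq0 (e : K) : units e -> e != 0.
Proof.
case=> _ [e' _ ee]; apply: contraTneq isT => e0; move/eqP: ee.
by rewrite e0 mul0r eq_sym oner_eq0.
Qed.

Lemma unitsV (e : K) : units e -> units e^-1.
Proof.
move=> ue; have e0 := units_neq0 ue; case: ue => Oe [e' Oe' ee].
have -> : e^-1 = e' by rewrite -[e']mul1r -(mulVf e0) -mulrA ee mulr1.
by split=> //; exists e; rewrite // mulrC.
Qed.

Lemma unitsM (e f : K) : units e -> units f -> units (e * f).
Proof.
move=> [Oe [e' Oe' ee]] [Of [f' Of' ff]]; split; first exact: OKM.
by exists (e' * f'); [exact: OKM|rewrite mulrACA ee ff mulr1].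
Qed.

Lemma units1 : units (1 : K).
Proof. by split; [exact: OK1|exists 1; [exact: OK1|rewrite mulr1]]. Qed.

Lemma unitsX (e : K) n : units e -> units (e ^+ n).
Proof.
by move=> ue; elim: n => [|n IH]; rewrite ?expr0 ?exprS; [exact: units1|exact: unitsM].
Qed.

Lemma units_unitp (e : K) : units e -> unitp e.
Proof.
move=> [Oe [e' Oe' ee]]; split=> // Pe; have [_] := unitp1 p_inert; apply.
by have := principalMr Oe' Pe; rewrite ee.
Qed.

(** Here [u] generates the totally positive units. [N] counts the orbits of multiplication by [u] on
    invertible residues and [t] is their common length; totally positive lifts of the orbit roots
    form the transversal for [class_number_fibers]. *)
Lemma ray_class_number k : (0 < k)%N -> exists N t : nat,
  [/\ (0 < t)%N, (N * t = p ^ (2 * k.-1) * (p ^ 2 - 1))%N,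
     forall n : nat, principal (pK ^+ k) (u ^+ n - 1) <-> (t %| n)%N &
     set_card (Cl R (principal (pK ^+ k))) = (N * set_card (Cl R (@OK K)))%N].
Proof.
case: k => // k _; have [w w_OK [w_conj w_basis]] := integral_basis quadK.
set q := (p ^ k.+1)%N; have q0 : (0 < q)%N by rewrite expn_gt0 prime_gt0.
have qE : pK ^+ k.+1 = q%:R by rewrite natrX.
pose T := ('I_q * 'I_q)%type; pose lift := @lift_res K w q.
have Olift (r : T) : OK (lift r) by exact: lift_res_OK.
have Ou : OK u by case: u_unit.
have uu n : unitp (u ^+ n) by apply: units_unitp; exact: unitsX.
(* The reduction must be total, so elements outside [OK] get an arbitrary residue. *)
have /choice[red redP] : forall x, exists r, OK x -> principal q%:R (x - lift r).
  move=> x.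
  have [Ox|nOx] := pselect (OK x).
    by have [r hr] := lift_res_ex w_OK w_basis q0 Ox; exists r.
  have [r _] := lift_res_ex w_OK w_basis q0 (OK0 K); by exists r.
have lift_inj (r r' : T) : principal q%:R (lift r - lift r') -> r = r'.
  exact: (lift_res_inj w_conj w_basis).
pose f (r : T) := red (lift r * u).
have fP r : principal q%:R (lift r * u - lift (f r)) by apply: redP; exact: OKM.
have cancel x y : unitp x -> OK y -> principal q%:R (x * y) -> principal q%:R y.
  by move=> ux Oy; rewrite -qE; exact: (unitp_cancel quadK p_prime p_inert ux Oy).
have f_inj : injective f.
  move=> r r' E; apply: lift_inj; apply: (cancel u); first by rewrite -[u]expr1.
    exact: OKB.
  have -> : u * (lift r - lift r') =
    (lift r * u - lift (f r)) - (lift r' * u - lift (f r')) by rewrite E; ring.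
  exact: principalB.
have iterP n r : principal q%:R (lift r * u ^+ n - lift (iter n f r)).
  elim: n => [|n IH] /=; first by rewrite expr0 mulr1 subrr; exact: principal0.
  have -> : lift r * u ^+ n.+1 - lift (f (iter n f r)) =
    u * (lift r * u ^+ n - lift (iter n f r)) + (lift (iter n f r) * u - lift (f (iter n f r))).
    by rewrite exprS; ring.
  by apply: principalD => //; exact: principalMl.
pose S := [set r : T | `[< unitp (lift r) >]]%SET.
(* [lift r] is cancellable mod [q], so the orbit of [r] closes after [n] steps exactly when
   [u ^ n = 1] mod [q], whatever [r] is. *)
have order_dvd r n : r \in S -> (principal q%:R (u ^+ n - 1) <-> (fingraph.order f r %| n)%N).
  rewrite inE => /asboolP ur; rewrite -iter_order_dvdn //; split=> [un|/eqP it].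
    apply/eqP/esym/lift_inj.
    have -> : lift r - lift (iter n f r) =
      (lift r * u ^+ n - lift (iter n f r)) - lift r * (u ^+ n - 1) by ring.
    by apply: principalB => //; exact: principalMl.
  apply: (cancel (lift r)) => //; first by apply: OKB; [exact: OKX|exact: OK1].
  by have := iterP n r; rewrite it mulrBr mulr1.
have unit_red x : unitp x -> red x \in S.
  move=> ux; rewrite inE; apply/asboolP.
  apply: (unitp_ndvd (k := k.+1) _ ux) => //.
  by rewrite qE; apply: redP; case: ux.
pose t := fingraph.order f (red 1).
have S1 : red 1 \in S by apply: unit_red; exact: unitp1.
have orderS r : r \in S -> fingraph.order f r = t.
  move=> rS; apply/eqP; rewrite eqn_dvd; apply/andP; split.
    by apply/(order_dvd r) => //; apply/(order_dvd (red 1)).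
  by apply/(order_dvd (red 1)) => //; apply/(order_dvd r).
have fclS : fclosed f S.
  move=> r _ /eqP <-; have fr := fP r; rewrite !inE; apply/asboolP/asboolP => ur.
    apply: (unitp_ndvd (k := k.+1) (x := lift r * u)) => //; last by rewrite qE.
    by apply: unitpM => //; rewrite -[u]expr1.
  have : unitp (lift r * u).
    apply: (unitp_ndvd (k := k.+1) (x := lift (f r))) => //; first exact: OKM.
    by rewrite qE -opprB; exact: principalN.
  move=> [_ nP]; split=> // Pr; apply: nP; exact: principalMr.
have cardS : (fcard f S * t = #|S|)%N.
  apply: fcard_order_set => //; apply/fintype.subsetP => r rS.
  by rewrite inE orderS.
pose X := [predI froots f & S].
have NX : fcard f S = #|X| by [].
have [M MP] := choice (fun r : T => tpos_shift (lift r) q0).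
pose rep r : K := lift r + (M r)%:R * q%:R.
have repq r : principal q%:R (rep r - lift r).
  by apply/principalP; exists (M r)%:R; [exact: OK_nat|rewrite /rep; ring].
have rep_OK r : OK (rep r).
  by apply: OKD => //; apply: OKM; exact: OK_nat.
have rep_unitp r : r \in S -> unitp (rep r).
  rewrite inE => /asboolP ur; apply: (unitp_ndvd (k := k.+1) _ ur) => //.
  by rewrite qE -opprB; exact: principalN (repq r).
have rep_root r r' (n : nat) : principal q%:R (rep r' - rep r * u ^+ n) ->
    froot f r = froot f r'.
  move=> h; apply/(fingraph.rootP (fconnect_sym f_inj)).
  have -> : r' = iter n f r; last exact: fconnect_iter.
  apply: lift_inj.
  have -> : lift r' - lift (iter n f r) = (rep r' - rep r * u ^+ n) +
    u ^+ n * (rep r - lift r) - (rep r' - lift r') + (lift r * u ^+ n - lift (iter n f r)) by ring.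
  apply: principalD => //; apply: principalB => //; apply: principalD => //.
  by apply: principalMl => //; exact: OKX.
exists #|X|, t; split=> //.
- exact: order_gt0.
- by rewrite -NX cardS /S (card_unit_res w_OK w_conj w_basis p_prime).
- by move=> n; rewrite qE; exact: order_dvd.
apply: (class_number_fibers quadK iota p_prime p_inert
  (rep := fun i : 'I_#|X| => rep (enum_val i))) => //.
- have : (0 < #|S|)%N.
    rewrite (card_unit_res w_OK w_conj w_basis p_prime) muln_gt0 expn_gt0 prime_gt0 //=.
    by rewrite subn_gt0 -{1}(exp1n 2) ltn_exp2r ?prime_gt1.
  by rewrite -cardS NX muln_gt0 => /andP[].
- move=> i; have /andP[_ iS] := enum_valP i; split; first exact: MP.
  by apply: hasv_unitp => //; exact: rep_unitp.
- move=> a ta [b [c [ub uc]]]; rewrite expr0z mul1r => aE.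
  have [c' Oc' cc'] := unitp_inv quadK p_prime p_inert k.+1 uc.
  have c0 := unitp_neq0 uc.
  have Ob : OK b by case: ub.
  have Oc : OK c by case: uc.
  have uc' : unitp c'.
    have : unitp (c * c').
      apply: (unitp_ndvd (k := k.+1) _ (unitp1 p_inert)) => //; first exact: OKM.
      by rewrite -opprB; exact: principalN.
    move=> [_ nP]; split=> // Pc'; apply: nP; exact: principalMl.
  (* The residue of [a = b / c]. It is [u ^ n] times the root [r0] of its orbit, so dividing [a] by
     [rep r0 * u ^ n] leaves a ray element. *)
  pose r := red (b * c'); have rS : r \in S by apply: unit_red; exact: unitpM.
  have rootS : froot f r \in X.
    apply/andP; split; first by apply: roots_root; exact: fconnect_sym.
    by rewrite -(closed_connect fclS (connect_root _ r)).
  have [n rE] : exists n, r = iter n f (froot f r).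
    exists (findex f (froot f r) r); rewrite iter_findex // fconnect_sym //.
    exact: connect_root.
  exists (enum_rank_in rootS (froot f r)), (a / (rep (froot f r) * u ^+ n)), (u ^+ n).
  rewrite enum_rankK_in //; set r0 := froot f r in rE rootS *.
  have r0S : r0 \in S by move: rootS; rewrite inE => /andP[].
  have r00 := unitp_neq0 (rep_unitp _ r0S).
  have u0 := unitp_neq0 (uu n).
  split.
  + apply: tposM => //; apply: tposV; apply: tposM; first exact: MP.
    exact: (tposXz n).
  + apply/(cong1P quadK p_prime p_inert) => //.
    exists b, (c * (rep r0 * u ^+ n)); split=> //.
    * by do 2 (apply: unitpM => //); exact: rep_unitp.
    * have := iterP n r0; rewrite -rE => h1; have h2 := redP _ (OKM Ob Oc'); rewrite -/r in h2.
      rewrite qE; rewrite qE in cc'.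
      have -> : b - c * (rep r0 * u ^+ n) = - b * (c * c' - 1) + c * (b * c' - lift r) -
        c * (lift r0 * u ^+ n - lift r) - c * u ^+ n * (rep r0 - lift r0) by ring.
      apply: principalB; last by apply: principalMl => //; apply: OKM => //; exact: OKX.
      apply: principalB; last exact: principalMl.
      apply: principalD; apply: principalMl => //; exact: OKN.
    * by rewrite aE; field; rewrite c0 r00 u0.
  + exact: unitsX.
  + by field; rewrite r00 u0.
move=> i j b e tb mb ue E.
have /andP[iR iS] := enum_valP i; have /andP[jR jS] := enum_valP j.
have ti := MP (enum_val i); have tj := MP (enum_val j).
have i0 := unitp_neq0 (rep_unitp _ iS).
(* A unit linking two representatives is a quotient of totally positive elements, hence a power of
   [u]. *)
have te : tpos e.
  have b0 := tpos_neq0 iota tb.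
  have -> : e = rep (enum_val j) / (rep (enum_val i) * b) by rewrite E; field; rewrite i0 b0.
  by apply: tposM => //; apply: tposV; exact: tposM.
have {mb} [b1 [c1 [ub1 uc1 bc1 bE]]] := (cong1P quadK p_prime p_inert _ (ltn0Sn k)).1 mb.
rewrite qE in bc1.
have c0 := unitp_neq0 uc1; have b0 := unitp_neq0 ub1.
have eqroots : froot f (enum_val i) = froot f (enum_val j).
  have [[n|n] eE] := u_gen ue te.
    apply: (rep_root _ _ n); apply: (cancel c1) => //.
      by apply: OKB => //; apply: OKM => //; exact: OKX.
    rewrite E bE eE -exprnP.
    have -> : c1 * (rep (enum_val i) * (b1 / c1) * u ^+ n - rep (enum_val i) * u ^+ n) =
      rep (enum_val i) * u ^+ n * (b1 - c1) by field.
    by apply: principalMl => //; apply: OKM => //; exact: OKX.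
  (* Orbits are iterated forwards only, so a negative exponent is handled by exchanging [i] and
     [j]. *)
  apply/esym; apply: (rep_root _ _ n.+1); apply: (cancel c1) => //.
    by apply: OKB => //; apply: OKM => //; exact: OKX.
  have u0 := unitp_neq0 (uu n.+1).
  rewrite E bE eE NegzE -exprnN.
  have -> : c1 * (rep (enum_val i) - rep (enum_val i) * (b1 / c1) / u ^+ n.+1 * u ^+ n.+1) =
      rep (enum_val i) * - (b1 - c1) by field; rewrite u0 c0.
  by apply: principalMl => //; exact: principalN.
by apply: enum_val_inj; rewrite -(eqP iR) -(eqP jR).
Qed.

End RayClassNumber.

(** * Pell's equation *)

Lemma pigeonhole_nat (F : finType) (f : nat -> F) : exists i j, (i < j)%N /\ f i = f j.
Proof.
apply: contrapT => noij.
have /leq_card : injective (fun i : 'I_(#|F|.+1) => f i).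
  move=> i j fij; apply: val_inj; case: (ltngtP (val i) (val j)) => // ij.
    by case: noij; exists (val i), (val j).
  by case: noij; exists (val j), (val i).
by rewrite card_ord ltnn.
Qed.

Section Pell.
Variables (R : realType) (s : R).

(** Pigeonhole: the fractional parts of the [N + 1] multiples [i * s], [i <= N], fall into [N] boxes
    of width [1 / N]. *)
Lemma dirichlet_approx (N : nat) : (0 < N)%N ->
  exists (x : int) (y : nat), (0 < y <= N)%N /\ `|x%:~R - y%:R * s| * N%:R < 1.
Proof.
move=> N0; have NR0 : 0 < N%:R :> R by rewrite ltr0n.
pose fr (i : nat) : R := i%:R * s - (Num.floor (i%:R * s))%:~R.
have fr0 i : 0 <= fr i by rewrite subr_ge0 floor_le.
have fr1 i : fr i < 1.
  by have := floorD1_gt (i%:R * s); rewrite rmorphD /= => h; rewrite /fr; lra.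
pose b (i : nat) := Num.truncn (fr i * N%:R).
have b_itv i : (b i)%:R <= fr i * N%:R < (b i)%:R + 1.
  have := @truncn_itv R (fr i * N%:R); rewrite -natr1; apply.
  by rewrite mulr_ge0.
have b_lt i : (b i < N)%N.
  rewrite -(ltr_nat R); have /andP[h _] := b_itv i; apply: le_lt_trans h _.
  by rewrite -[ltRHS]mul1r ltr_pM2r.
have [i [j [ij bij]]] : exists i j : 'I_N.+1, (i < j)%N /\ b i = b j.
  apply: contrapT => noij.
  have /leq_card : injective (fun i : 'I_N.+1 => Ordinal (b_lt i)).
    move=> i j [] fij; apply: val_inj; case: (ltngtP (val i) (val j)) => // ij.
      by case: noij; exists i, j.
    by case: noij; exists j, i.
  by rewrite !card_ord ltnn.
exists (Num.floor (j%:R * s) - Num.floor (i%:R * s)), (j - i)%N; split.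
  by rewrite subn_gt0 ij /= (leq_trans (leq_subr _ _)) // -ltnS.
have -> : (Num.floor (j%:R * s) - Num.floor (i%:R * s))%:~R - (j - i)%N%:R * s = fr i - fr j.
  by rewrite rmorphB /= natrB 1?ltnW // /fr; ring.
rewrite -[X in _ * X]ger0_norm ?ltW // -normrM mulrBl.
have /andP[h1 h2] := b_itv i; have /andP[h3 h4] := b_itv j.
by rewrite bij in h1 h2; rewrite ltr_norml; apply/andP; split; lra.
Qed.

Variable d : nat.
Hypothesis s2 : s ^+ 2 = d%:R.
Hypothesis s_ge0 : 0 <= s.
Hypothesis s_irrat : forall a b : int, a%:~R = b%:~R * s -> b = 0.

Definition pell_norm (z : int * int) : int := z.1 ^+ 2 - d%:Z * z.2 ^+ 2.
Definition pell_val (z : int * int) : R := z.1%:~R - z.2%:~R * s.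

Lemma pell_normE z : (pell_norm z)%:~R = pell_val z * (z.1%:~R + z.2%:~R * s).
Proof.
rewrite /pell_norm /pell_val !expr2 rmorphB !rmorphM /= -pmulrn -s2; ring.
Qed.

Lemma pell_val_eq0 z : pell_val z = 0 -> z = (0, 0).
Proof.
case: z => x y; rewrite /pell_val /= => /eqP; rewrite subr_eq0 => /eqP xy.
have y0 := s_irrat xy; move: xy; rewrite y0 mul0r => /eqP.
by rewrite intr_eq0 => /eqP ->.
Qed.

(** The norm is [v * (v + 2 y s)] for the small value [v]. Dirichlet gives [|v| y <= 1] and
    [|v| <= 1], whence the bound [2 s + 1] independent of [e]. *)
Lemma pell_small (e : R) : 0 < e -> exists z : int * int,
  [/\ pell_val z != 0, `|pell_val z| < e & `|pell_norm z|%:~R <= 2%:R * s + 1].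
Proof.
move=> e0; pose N := (Num.bound e^-1).+1.
have Ne : 1 < e * N%:R.
  rewrite -ltr_pdivrMl // mulr1 (lt_trans (archi_boundP _)) ?invr_ge0 ?(ltW e0) //.
  by rewrite ltr_nat.
have [x [y [/andP[y0 yN] xy]]] := dirichlet_approx (ltn0Sn (Num.bound e^-1)).
rewrite -/N in yN xy; exists (x, y%:Z).
have N1 : 1 <= N%:R :> R by rewrite ler1n.
have yNR : y%:R <= N%:R :> R by rewrite ler_nat.
have vE : pell_val (x, y%:Z) = x%:~R - y%:R * s by rewrite /pell_val /= -pmulrn.
set v := pell_val _ in vE *; rewrite -vE in xy.
have v1 : `|v| <= 1 by have := normr_ge0 v; nra.
split.
- by apply/eqP => /pell_val_eq0 [_]; lia.
- by rewrite -(ltr_pM2r (_ : 0 < N%:R)) ?(lt_trans xy) //; lra.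
have nE : (`|pell_norm (x, y%:Z)|)%:~R = `|v| * `|v + 2%:R * (y%:R * s)| :> R.
  rewrite intr_norm pell_normE normrM; congr (_ * `|_|).
  by rewrite vE /= -pmulrn; ring.
rewrite nE; have ys0 : 0 <= y%:R * s by rewrite mulr_ge0.
have tri : `|v + 2%:R * (y%:R * s)| <= 1 + 2%:R * (y%:R * s).
  by rewrite (le_trans (ler_normD _ _)) // lerD // ger0_norm // mulr_ge0.
have vy : `|v| * y%:R <= 1.
  by rewrite (le_trans _ (ltW xy)) // ler_wpM2l.
have := normr_ge0 v; move: (`|v + _|) tri => W tri v0.
apply: le_trans (_ : `|v| * (1 + 2%:R * (y%:R * s)) <= _); first exact: ler_wpM2l.
have : `|v| * y%:R * s <= 1 * s by apply: ler_wpM2r.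
lra.
Qed.

(** Infinitely many pairs have bounded norm, so two of them share a norm [n] and are congruent mod
    [n]; their quotient is an integer of norm 1. *)
Lemma pell_solution : exists a b : int, b != 0 /\ a ^+ 2 - d%:Z * b ^+ 2 = 1.
Proof.
pose C := Num.bound (2%:R * s + 1).
pose good z := pell_val z != 0 /\ (`|pell_norm z| < C)%N.
have small e : 0 < e -> exists z, good z /\ `|pell_val z| < e.
  move=> /pell_small[z [z0 ze zC]]; exists z; do 2 split=> //.
  rewrite -ltz_nat -(ltr_int R) abszE; apply: le_lt_trans zC _.
  by apply: archi_boundP; rewrite addr_ge0 // mulr_ge0.
have [z0 [good0 _]] := small 1 ltr01.
(* The strict decrease is kept to exclude the quotients 1 and -1 at the end. *)
have /choice[nxt nxtP] : forall z, exists z', good z -> good z' /\ `|pell_val z'| < `|pell_val z|.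
  move=> z; have [[zn0 zC]|ng] := pselect (good z); last by exists z.
  by have [|z' hz'] := small `|pell_val z|; [rewrite normr_gt0|exists z'].
pose zs n := iter n nxt z0.
have goods n : good (zs n) by elim: n => [//|n /nxtP[]].
have decr i j : (i < j)%N -> `|pell_val (zs j)| < `|pell_val (zs i)|.
  elim: j => // j IH; rewrite ltnS leq_eqVlt => /orP[/eqP ->|/IH h].
    by have [] := nxtP _ (goods j).
  by apply: lt_trans h; have [] := nxtP _ (goods j).
have C0 : (0 < C)%N by have [_] := goods 0%N; exact: leq_ltn_trans.
pose nn z := `|pell_norm z|%N.
(* Sign and size of the norm, and the coordinates modulo it. All these numbers are below [C], so
   [inord] loses nothing. *)
pose key z := (pell_norm z < 0, inord (n' := C) (nn z) , inord (n' := C) `|(z.1 %% (nn z)%:Z)%Z|%N,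
  inord (n' := C) `|(z.2 %% (nn z)%:Z)%Z|%N).
have [i [j [ij]]] := pigeonhole_nat (fun n => key (zs n)).
have := decr _ _ ij; have [vi gi] := goods i; have [vj gj] := goods j.
case: (zs i) (zs j) vi gi vj gj => [x1 y1] [x2 y2] vi gi vj gj lt_v [sgE nE xE yE].
have nE' : nn (x1, y1) = nn (x2, y2).
  by move/(congr1 val): nE; rewrite /= !inordK // ltnS ltnW.
have normE : pell_norm (x1, y1) = pell_norm (x2, y2).
  move: nE' sgE; rewrite /nn.
  by case: (pell_norm (x1, y1)) => m; case: (pell_norm (x2, y2)) => m' /=; lia.
have n0 : pell_norm (x1, y1) != 0.
  apply/eqP => n0; have := pell_normE (x1, y1); rewrite n0 => /esym/eqP.
  rewrite mulf_eq0 (negPf vi) /= => /eqP E.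
  have : pell_val (x1, - y1) = 0 by rewrite /pell_val /= rmorphN /= mulNr opprK.
  move/pell_val_eq0 => [x10 y10]; move: vi; rewrite /pell_val /= x10.
  move/eqP: y10; rewrite oppr_eq0 => /eqP ->.
  by rewrite !mulr0z mul0r subr0 eqxx.
set n := pell_norm (x1, y1) in normE n0.
have lt_mod (c : int) : (`|(c %% (nn (x1, y1))%:Z)%Z| < C.+1)%N.
  have m0 : (nn (x1, y1))%:Z != 0 by rewrite /nn -/n; lia.
  rewrite -ltz_nat gez0_abs ?modz_ge0 // (lt_trans (ltz_pmod _ _)) //; first by lia.
  by rewrite ltz_nat ltnS ltnW.
have modE (c c' : int) : inord (n' := C) `|(c %% (nn (x1, y1))%:Z)%Z|%N =
    inord (n' := C) `|(c' %% (nn (x1, y1))%:Z)%Z|%N -> exists e, c = c' + n * e.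
  move/(congr1 val); rewrite /= !inordK // => E.
  have m0 : (nn (x1, y1))%:Z != 0 by rewrite /nn -/n; lia.
  have : (c = c' %[mod (nn (x1, y1))%:Z])%Z.
    by rewrite -[LHS]gez0_abs ?modz_ge0 // E gez0_abs ?modz_ge0.
  move/eqP; rewrite eqz_mod_dvd => /dvdzP[e eE].
  exists (sgz n * e); rewrite mulrA [n * _]mulrC -abszEsg.
  by rewrite mulrC -[X in _ * X]/((nn (x1, y1))%:Z) -eE addrC subrK.
move: xE yE; rewrite /= -nE' => /modE[e xE] /modE[f yE].
have nE1 : x1 ^+ 2 - d%:Z * y1 ^+ 2 = n by [].
have nE2 : x2 ^+ 2 - d%:Z * y2 ^+ 2 = n by rewrite normE.
(* [a - b s] is the quotient of the two values: the product of the first with the conjugate of the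
   second is [n (a - b s)], and [n] cancels because [x1 = x2 + n e] and [y1 = y2 + n f]. *)
pose a := 1 + e * x2 - d%:Z * f * y2; pose b := f * x2 - e * y2.
have aE : n * a = x1 * x2 - d%:Z * y1 * y2.
  by rewrite /a xE yE mulrBr mulrDr mulr1 -{1}nE2; ring.
have bE : n * b = y1 * x2 - x1 * y2 by rewrite /b xE yE; ring.
exists a, b; have pell : a ^+ 2 - d%:Z * b ^+ 2 = 1.
  apply: (mulfI (mulf_neq0 n0 n0)).
  have -> : n * n * (a ^+ 2 - d%:Z * b ^+ 2) = (n * a) ^+ 2 - d%:Z * (n * b) ^+ 2 by ring.
  by rewrite aE bE mulr1 -{1}nE1 -nE2; ring.
(* With [b = 0] the quotient is 1 or -1, so both values have the same absolute value. *)
split=> //; apply/eqP => b0; move: pell; rewrite b0 expr0n mulr0 subr0 => a2.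
have vv : pell_val (x1, y1) * (x2%:~R + y2%:~R * s) = (n * a)%:~R.
  have : (n * b)%:~R = 0 :> R by rewrite b0 mulr0.
  rewrite aE bE !rmorphB !rmorphM /= -pmulrn -s2 /pell_val /= => h.
  have -> : (x1%:~R - y1%:~R * s) * (x2%:~R + y2%:~R * s) =
    (x1%:~R * x2%:~R - s ^+ 2 * y1%:~R * y2%:~R) - s * (y1%:~R * x2%:~R - x1%:~R * y2%:~R) by ring.
  by rewrite h mulr0 subr0.
have c0 : x2%:~R + y2%:~R * s != 0.
  apply: contraTneq isT => c0; move: n0; rewrite normE -(intr_eq0 R) pell_normE.
  by rewrite /= c0 mulr0 eqxx.
have : `|pell_val (x1, y1)| * `|x2%:~R + y2%:~R * s| = `|pell_val (x2, y2)| * `|x2%:~R + y2%:~R * s|.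
  rewrite -!normrM vv -(pell_normE (x2, y2)) -normE rmorphM normrM.
  have /eqP : a ^+ 2 == 1 by rewrite a2.
  by move/eqP; rewrite sqrf_eq1 => /orP[] /eqP ->; rewrite ?rmorphN ?normrN normr1 mulr1.
move/(mulIf (_ : `|x2%:~R + y2%:~R * s| != 0)); rewrite normr_eq0 => /(_ c0) E.
by move: lt_v; rewrite E ltxx.
Qed.

End Pell.

(** * Order of the totally positive unit modulo powers of p *)

Section Order.
Variables (K : splittingFieldType rat) (tau : {rmorphism K -> K}).
Hypothesis quadK : quadratic tau.
Variable p : nat.
Hypothesis p_prime : prime p.
Hypothesis p_inert : prime_ideal (principal (p%:R : K)).
Implicit Types (x y z : K).

Local Notation pK := (p%:R : K).
Local Notation unitp := (@OK K `\` principal pK).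
Local Notation hasv := (hasv p).

(** First-order expansion at 1, for evaluating [1 + x + ... + x ^ (p - 1)] mod [p ^ 2]. *)
Lemma expr_sub1_mod2 x i : OK x ->
  principal ((x - 1) ^+ 2) (x ^+ i - 1 - i%:R * (x - 1)).
Proof.
move=> Ox; elim: i => [|i IH].
  by rewrite expr0 mul0r subrr subr0; exact: principal0.
have -> : x ^+ i.+1 - 1 - i.+1%:R * (x - 1) =
    x * (x ^+ i - 1 - i%:R * (x - 1)) + i%:R * (x - 1) ^+ 2.
  by rewrite exprS -natr1; ring.
apply: principalD; first exact: principalMl.
apply: principalMl; first exact: OK_nat.
by apply/principalP; exists 1; rewrite ?mulr1 //; exact: OK1.
Qed.

(* p must be odd or x - 1 divisible by p ^ 2: -1 is 1 mod 2 but its square is 1. *)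
Lemma hasv_exp_sub1 x m : OK x -> (0 < m)%N -> ((2 < p) || (1 < m))%N ->
  hasv (x - 1) m%:Z -> hasv (x ^+ p - 1) m.+1%:Z.
Proof.
move=> Ox m0 pm hm; rewrite subrX1 -addn1 PoszD; apply: hasvM => //.
have Oy : OK (x - 1) by apply: OKB => //; exact: OK1.
have ym : principal (pK ^+ m) (x - 1) by apply/(principal_hasv p_prime p_inert m Oy hm).
set S := \sum_(i < p) _.
(* [S] is [p + 'C(p, 2) (x - 1)] mod [p ^ 2], and the second term vanishes because [p] divides the
   binomial for odd [p], or [p ^ 2] divides [x - 1]. So [S] contributes exactly one factor [p]. *)
have : principal (pK ^+ 2) (S - pK).
  have SE : S - pK = \sum_(i < p) (x ^+ i - 1 - i%:R * (x - 1)) + 'C(p, 2)%:R * (x - 1).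
    rewrite -bin2_sum natr_sum mulr_suml big_mkord -big_split /=.
    under [RHS]eq_bigr => i _ do rewrite subrK.
    by rewrite sumrB big_const_ord iter_addr addr0 /S.
  rewrite SE; apply: principalD.
    elim/big_ind: _ => [|a b|i _]; [exact: principal0|exact: principalD|].
    have /principalP[t Ot ->] := expr_sub1_mod2 i Ox.
    have /principalP[r Or ->] : principal pK (x - 1).
      by rewrite -[pK]expr1; apply: principalX_le m0 ym; exact: OK_nat.
    apply/principalP; exists (r ^+ 2 * t); first exact: OKM (OKX _ Or) Ot.
    by ring.
  case/orP: pm => [p2|m1]; last first.
    apply: principalMl; first exact: OK_nat.
    by apply: principalX_le m1 ym; exact: OK_nat.
  have /dvdnP[c ->] : (p %| 'C(p, 2))%N by apply: prime_dvd_bin.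
  have /principalP[r Or ->] : principal pK (x - 1).
    by rewrite -[pK]expr1; apply: principalX_le m0 ym; exact: OK_nat.
  apply/principalP; exists (c%:R * r); first by apply: OKM => //; exact: OK_nat.
  by rewrite natrM; ring.
case/principalP => z Oz /eqP; rewrite subr_eq => /eqP ->.
have -> : pK ^+ 2 * z + pK = (pK ^ 1) * (1 + pK * z) by rewrite expr1z; ring.
rewrite -[1%N%:Z]addr0; apply: hasvM => //; first exact: hasv_p.
apply: hasv_unitp => //.
apply: (unitp_ndvd (k := 1) (x := 1)) => //; first exact: unitp1.
  by apply: OKD; [exact: OK1|apply: OKM => //; exact: OK_nat].
apply/principalP; exists (- z); first exact: OKN.
by rewrite expr1; ring.
Qed.

Lemma hasv_expX_sub1 x m j : OK x -> (0 < m)%N -> ((2 < p) || (1 < m))%N ->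
  hasv (x - 1) m%:Z -> hasv (x ^+ (p ^ j) - 1) (m + j)%N%:Z.
Proof.
move=> Ox m0 pm hm; elim: j => [|j IH]; first by rewrite expn0 expr1 addn0.
rewrite expnSr exprM addnS; apply: hasv_exp_sub1 => //; first exact: OKX.
  by rewrite addn_gt0 m0.
by case/orP: pm => [->//|m1]; rewrite (leq_trans m1) ?orbT // leq_addr.
Qed.

Section Unit.
Variable u : K.
Hypothesis u_OK : OK u.
Variable t : nat -> nat.
Hypothesis tP : forall k, (0 < k)%N ->
  forall n : nat, principal (pK ^+ k) (u ^+ n - 1) <-> (t k %| n)%N.

Lemma order_dvd_le j k : (0 < j)%N -> (j <= k)%N -> (t j %| t k)%N.
Proof.
move=> j0 jk; have k0 := leq_trans j0 jk; apply/(tP j0).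
by apply: (principalX_le _ jk); [exact: OK_nat|exact/(tP k0)].
Qed.

Lemma order_le_val m k : (0 < k)%N -> (k <= m)%N ->
  hasv (u ^+ t 1 - 1) m%:Z -> t k = t 1.
Proof.
move=> k0 km hm; apply/eqP; rewrite eqn_dvd (order_dvd_le (ltn0Sn 0) k0) andbT.
apply/tP => //; apply/(principal_hasv p_prime p_inert k _ hm) => //.
by apply: OKB; [exact: OKX|exact: OK1].
Qed.

(** [t k / t 1] divides [p ^ (k - m)], so it is some [p ^ i]; the power then has valuation exactly
    [m + i], which reaches [k] only for [i = k - m]. *)
Lemma order_ge_val m k : (0 < m)%N -> ((2 < p) || (1 < m))%N -> (m <= k)%N ->
  (0 < t 1)%N -> hasv (u ^+ t 1 - 1) m%:Z -> t k = (t 1 * p ^ (k - m))%N.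
Proof.
move=> m0 pm mk s0 hm; have k0 : (0 < k)%N by exact: leq_trans mk.
have OX n : OK (u ^+ n - 1) by apply: OKB; [exact: OKX|exact: OK1].
have val j : hasv (u ^+ (t 1 * p ^ j) - 1) (m + j)%N%:Z.
  by rewrite exprM; apply: hasv_expX_sub1 => //; exact: OKX.
have /dvdnP[c cE] := order_dvd_le (ltn0Sn 0) k0; rewrite mulnC in cE.
have : (t k %| t 1 * p ^ (k - m))%N.
  by apply/tP => //; apply/(principal_hasv p_prime p_inert k (OX _) (val _)); rewrite subnKC.
rewrite cE dvdn_pmul2l // => /(dvdn_pfactor _ _ p_prime)[i ikm cp].
have : principal (pK ^+ k) (u ^+ t k - 1) by apply/tP.
rewrite cE cp => /(principal_hasv p_prime p_inert k (OX _) (val _)) kmi.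
by congr (_ * _ ^ _)%N; apply/eqP; rewrite eqn_leq ikm leq_subLR.
Qed.

(** In [(x - 1) (x - 1 + 2)] the second factor is even as well. *)
Lemma principal2_sqr x k : p = 2%N -> OK x -> (0 < k)%N -> principal (pK ^+ k) (x - 1) ->
  principal (pK ^+ k.+1) (x ^+ 2 - 1).
Proof.
move=> p2 Ox k0 xk; have /principalP[r Or rE] : principal pK (x - 1).
  by rewrite -[pK]expr1; apply: principalX_le k0 xk; exact: OK_nat.
case/principalP: xk => s Os sE; apply/principalP; exists (s * (r + 1)).
  by apply: OKM => //; apply: OKD => //; exact: OK1.
have -> : x ^+ 2 - 1 = (x - 1) * ((x - 1) + 2%:R) by ring.
by rewrite {1}sE rE p2 exprS; ring.
Qed.

(** Squaring shows that [t k.+1 / t k] divides 2. It is not 1: [u ^ (6 * 2 ^ (k - m)) - 1] has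
    valuation exactly [k], so [t k] divides that exponent and [t k.+1] does not. *)
Lemma order_double m k : p = 2%N -> (1 < m)%N -> (m <= k)%N -> (0 < t k)%N ->
  hasv (u ^+ 6 - 1) m%:Z -> t k.+1 = (2 * t k)%N.
Proof.
move=> p2 m1 mk tk0 hm; have k0 : (0 < k)%N by apply: leq_trans mk; apply: ltn_trans m1.
have OX n : OK (u ^+ n - 1) by apply: OKB; [exact: OKX|exact: OK1].
have val j : hasv (u ^+ (6 * p ^ j) - 1) (m + j)%N%:Z.
  rewrite exprM; apply: hasv_expX_sub1 => //; [exact: OKX|exact: ltn_trans m1|].
  by rewrite m1 orbT.
have /dvdnP[c cE] := order_dvd_le k0 (leqnSn k).
have : (t k.+1 %| 2 * t k)%N.
  apply/tP => //; rewrite mulnC exprM; apply: principal2_sqr => //; first exact: OKX.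
  exact/tP.
rewrite cE dvdn_pmul2r // => c2.
have c_le := dvdn_leq (isT : (0 < 2)%N) c2.
have c0 : c != 0%N by apply: contraTneq c2 => ->.
have c1 : c != 1%N.
  apply/eqP => c1; rewrite c1 mul1n in cE.
  have : (t k.+1 %| 6 * p ^ (k - m))%N.
    rewrite cE; apply/tP => //; apply/(principal_hasv p_prime p_inert k (OX _) (val _)).
    by rewrite subnKC.
  move=> /(tP (ltn0Sn k) _).2 /(principal_hasv p_prime p_inert k.+1 (OX _) (val _)).
  by rewrite subnKC // ltnn.
by congr (_ * _)%N; lia.
Qed.

End Unit.
End Order.

(** * Totally positive units and the index [s_dp] *)

Section FundamentalUnit.
Variables (R : realType) (d : nat).
Hypothesis d_gt1 : (1 < d)%N.
Hypothesis d_sqf : squarefree d.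
Variables (K : splittingFieldType rat) (iota : {rmorphism K -> R}) (sqrtd : K).
Hypothesis sqrtdE : iota sqrtd = Num.sqrt d%:R.
Hypothesis K_gen : (<<1%VS; sqrtd>> = {: K})%VS.

Lemma sqrtd_sqr : sqrtd ^+ 2 = d%:R.
Proof.
by apply: (fmorph_inj iota); rewrite rmorphXn rmorph_nat sqrtdE sqr_sqrtr // ler0n.
Qed.

Variable tau : {rmorphism K -> K}.
Hypothesis tau_sqrtd : tau sqrtd = - sqrtd.
Hypothesis normE : forall x : K, normQ x = x * tau x.

Lemma embeddingP (sigma : {rmorphism K -> R}) : sigma =1 iota \/ sigma =1 iota \o tau.
Proof.
have := congr1 sigma sqrtd_sqr; rewrite rmorphXn rmorph_nat.
have <- : iota sqrtd ^+ 2 = d%:R by rewrite -rmorphXn sqrtd_sqr rmorph_nat.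
move/eqP; rewrite eqf_sqr => /orP[] /eqP sE; [left|right] => x;
  have [a [b ->]] := quad_coord sqrtd_sqr K_gen x;
  rewrite /= !rmorphD !rmorphM /= sE ?(tau_rat tau) !rmorph_in_alg //.
by rewrite tau_sqrtd rmorphN.
Qed.

(** Needed because [fundamental_unit] would be satisfied by [u = 1] if 1 and -1 were the only
    units. *)
Lemma nontrivial_unit : exists2 e : K, units e & e != 1 /\ e != -1.
Proof.
have sqi (a b : int) : a%:~R = b%:~R * iota sqrtd -> b = 0.
  move=> ab; apply/eqP; apply: contraT => b0.
  have /negP[] := sqrtd_irrat d_sqf d_gt1 sqrtd_sqr (a%:~R / b%:~R).
  have b0' : (b%:~R : K) != 0.
    by rewrite -[0]/(0%:~R); apply: contraNneq b0 => /K_intr_inj ->.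
  apply/eqP; rewrite -[_%:A]/(in_alg K _) fmorph_div !rmorph_int.
  apply: (mulIf b0'); rewrite divfK // [RHS]mulrC; apply: (fmorph_inj iota).
  by rewrite rmorphM !rmorph_int.
have s2 : iota sqrtd ^+ 2 = d%:R by rewrite -rmorphXn sqrtd_sqr rmorph_nat.
have s0 : 0 <= iota sqrtd by rewrite sqrtdE sqrtr_ge0.
have [a [b [b0 ab]]] := pell_solution s2 s0 sqi.
have Osd : OK sqrtd.
  apply: (@trace_norm_OK _ tau _ 0 (- d%:Z)); first by rewrite tau_sqrtd subrr.
  by rewrite tau_sqrtd mulrN -expr2 sqrtd_sqr rmorphN.
have Oe (c : int) : OK (a%:~R + c%:~R * sqrtd).
  by apply: OKD; [exact: OK_int|apply: OKM => //; exact: OK_int].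
exists (a%:~R + b%:~R * sqrtd).
  split => //; exists (a%:~R + (- b)%:~R * sqrtd) => //.
  have := congr1 (intr : int -> K) ab; rewrite rmorphB rmorphM !expr2 !rmorphM /= -pmulrn -sqrtd_sqr.
  by move=> E; rewrite rmorphN /= -[RHS]/(1%:~R) -E; ring.
have ne (c : int) : a%:~R + b%:~R * sqrtd != c%:~R.
  apply/eqP => E; have := @quad_coord_inj d K sqrtd d_sqf d_gt1 sqrtd_sqr a%:~R b%:~R c%:~R 0.
  rewrite !in_alg_int scale0r mul0r addr0 => /(_ E)[_ /eqP].
  by rewrite intr_eq0 (negPf b0).
by split; [exact: (ne 1)|exact: (ne (-1))].
Qed.

Lemma unit_norm (e : K) : units e -> normQ e = 1 \/ normQ e = -1.
Proof.
have quadK := quadraticP d_sqf d_gt1 sqrtd_sqr K_gen tau_sqrtd.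
move=> [Oe [f Of ef]]; rewrite normE.
have [n nE] := norm_int quadK Oe; have [n' nE'] := norm_int quadK Of.
have nn : n * n' = 1.
  apply: (@K_intr_inj K); rewrite rmorphM /= -nE -nE' mulrACA -rmorphM ef.
  by rewrite rmorph1 mulr1.
rewrite nE; have : n \is a GRing.unit by apply/unitrP; exists n'; rewrite mulrC nn.
by case/orP => /eqP ->; [left|right].
Qed.

Variable u : K.
Hypothesis u_fund : fundamental_unit iota u.

Let tposE := tposP (embeddingP).

Lemma fund_neq1 : u != 1.
Proof.
apply/eqP => u1; have [e ue [e1 eN1]] := nontrivial_unit.
have [_ _ /(_ e ue)[n []]] := u_fund; rewrite u1 exp1rz => eE.
  by rewrite eE eqxx in e1.
by rewrite eE eqxx in eN1.
Qed.

Lemma u0E : u0 u = u /\ normQ u = 1 \/ u0 u = u ^+ 2 /\ normQ u = -1.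
Proof.
have [uu _ _] := u_fund; rewrite /u0; case: (unit_norm uu) => nu.
  by left; rewrite nu eqxx.
right; rewrite nu; split=> //; case: ifP => // /eqP E.
have : (2%:R : K) = 0 by rewrite -[2%:R]/(1 + 1) -{1}E addNr.
by move/eqP; rewrite K_natr_eq0.
Qed.

Lemma units_u0 : units (u0 u).
Proof.
have [uu _ _] := u_fund.
by case: u0E => -[-> _] //; exact: unitsX.
Qed.

Lemma iota_norm (x : K) : iota (normQ x) = iota x * iota (tau x).
Proof. by rewrite normE rmorphM. Qed.

Lemma tpos_u0 : totally_positive R (u0 u).
Proof.
have [uu u_pos _] := u_fund; have un0 := units_neq0 uu.
apply/tposE; case: u0E => -[-> nu].
  split=> //; have := iota_norm u; rewrite nu rmorph1 => E.
  by rewrite -(pmulr_rgt0 _ u_pos) -E.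
by rewrite !rmorphXn; split; rewrite exprn_even_gt0 // ?fmorph_eq0.
Qed.

(** Positivity at [iota] fixes the sign in [e = u ^ n] or [e = - u ^ n]. If the norm of [u] is -1,
    its conjugate is negative, so positivity at the other embedding makes [n] even. *)
Lemma u0_generates (e : K) : units e -> totally_positive R e -> exists n : int, e = u0 u ^ n.
Proof.
move=> ue /tposE[e1 e2]; have [uu u_pos ugen] := u_fund.
have [n [eE|eE]] := ugen e ue; last first.
  by move: e1; rewrite eE rmorphN oppr_gt0 fmorphXz ltNge ltW // exprz_gt0.
case: u0E => -[-> nu]; first by exists n.
have [m [nE|nE]] : exists m : int, n = 2 * m \/ n = 2 * m + 1.
  exists (n %/ 2)%Z; have := divz_eq n 2; have := ltz_pmod n (isT : 0 < 2 :> int).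
  by have := modz_ge0 n (isT : 2 != 0 :> int); lia.
  by exists m; rewrite eE nE -exprz_exp.
have un0 := units_neq0 uu.
have tu : iota (tau u) < 0.
  have := iota_norm u; rewrite nu rmorphN1 => E.
  by rewrite -(pmulr_rlt0 _ u_pos) -E oppr_lt0 ltr01.
have u2m : 0 < iota (tau ((u ^+ 2) ^ m)).
  by rewrite !fmorphXz exprz_gt0 // !rmorphXn exprn_even_gt0 // !fmorph_eq0.
move: e2; rewrite eE nE expfzDr // expr1z -exprz_exp -exprnP rmorphM rmorphM /=.
by rewrite (pmulr_rgt0 _ u2m) ltNge (ltW tu).
Qed.

Lemma u0_neq1 n : (0 < n)%N -> u0 u ^+ n != 1.
Proof.
move=> n0; have [uu u_pos _] := u_fund.
have un1 m : (0 < m)%N -> u ^+ m != 1.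
  move=> m0; apply: contraNneq fund_neq1 => um; apply/eqP/(fmorph_inj iota).
  have := congr1 iota um; rewrite rmorphXn rmorph1 => /eqP.
  by rewrite pexpr_eq1 -?lt0n // ?ltW // => /eqP.
by case: u0E => -[-> _]; [exact: un1|rewrite -exprM; apply: un1; rewrite muln_gt0].
Qed.

(** [v ^ t] lies in the subgroup, so every coset is that of some [v ^ i] with [i < t]; two such
    cosets agree only if [t] divides the difference of the exponents. *)
Lemma s_dpE p (t : nat) : prime p -> prime_ideal (principal (p%:R : K)) -> (0 < t)%N ->
  (forall n : nat, principal (p%:R : K) (u0 u ^+ n - 1) <-> (t %| n)%N) -> s_dp R K p = t.
Proof.
move=> p_prime p_inert t0 tP; rewrite /s_dp.
have quadK := quadraticP d_sqf d_gt1 sqrtd_sqr K_gen tau_sqrtd.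
set v := u0 u; have uv : units v := units_u0; have tv : totally_positive R v := tpos_u0.
have v0 : v != 0 := units_neq0 uv.
set U := units_pos_mod R p.
have UM (x y : K) : U x -> U y -> U (x * y).
  move=> [[ux tx] px] [[uy ty] py]; split; first by split; [exact: unitsM|exact: tposM].
  have -> : x * y - 1 = x * (y - 1) + (x - 1) by ring.
  by apply: principalD => //; apply: principalMl => //; case: ux.
have UV (x : K) : U x -> U x^-1.
  move=> [[ux tx] px]; have x0 := units_neq0 ux; have uV := unitsV ux.
  split; first by split; [|exact: tposV].
  have -> : x^-1 - 1 = - x^-1 * (x - 1) by field.
  by apply: principalMl => //; apply: OKN; case: uV.
have U1 : U 1.
  split; first by split; [exact: units1|exact: tpos1].
  by rewrite subrr; exact: principal0.
have Uvt (c : int) : U (v ^ (t%:Z * c)).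
  have Un (n : nat) : U (v ^+ (t * n)).
    split; first by split; [exact: unitsX|exact: (tposXz (t * n)%N)].
    by apply/tP; rewrite dvdn_mulr.
  case: c => n; first exact: Un.
  by rewrite NegzE mulrN -invr_expz; apply: UV; exact: Un.
have cosetE (x z : K) : U z -> [set x * z * h | h in U] = [set x * h | h in U].
  move=> Uz; apply/seteqP; split=> _ [h Uh <-].
    by exists (z * h); [exact: UM|rewrite mulrA].
  exists (z^-1 * h); first by apply: UM => //; exact: UV.
  by have := units_neq0 Uz.1.1 => z0; field.
have -> : cosets *%R (@units_pos R K) U = range (fun i : 'I_t => [set v ^+ i * h | h in U]).
  apply/seteqP; split=> C.
    case=> x [ux tx] <-; have [n ->] := u0_generates ux tx.
    have tZ : t%:Z != 0 by rewrite -lt0n.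
    have lt : (`|(n %% t)%Z| < t)%N.
      by rewrite -ltz_nat gez0_abs ?modz_ge0 // ltz_pmod // ltz_nat.
    exists (Ordinal lt) => //=; rewrite {2}(divz_eq n t) addrC expfzDr //.
    rewrite [X in v ^ (_) * v ^ X]mulrC cosetE //.
    by rewrite exprnP gez0_abs // modz_ge0.
  case=> i _ <-; exists (v ^+ i) => //; split; first exact: unitsX.
  exact: (tposXz i).
rewrite set_card_range ?card_ord //.
suff main (i j : 'I_t) : (i <= j)%N ->
    [set v ^+ i * h | h in U] = [set v ^+ j * h | h in U] -> i = j.
  by move=> i j E; case: (leqP i j) => [ij|/ltnW ji]; [exact: main|apply/esym/main].
move=> ij E; have : [set v ^+ j * h | h in U] (v ^+ j) by exists 1; rewrite ?mulr1.
rewrite -E => -[h [_ hp] vE]; apply: val_inj; apply/eqP; rewrite eqn_leq ij /=.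
have : (t %| j - i)%N.
  apply/tP; apply: (unitp_cancel quadK p_prime p_inert (k := 1) (x := v ^+ i)).
  - by apply: (units_unitp p_inert); exact: unitsX.
  - by apply: OKB; [apply: OKX; case: uv|exact: OK1].
  rewrite expr1 mulrBr -exprD subnKC // mulr1 -vE -{2}[v ^+ i]mulr1 -mulrBr.
  by apply: principalMl => //; apply: OKX; case: uv.
rewrite -subn_eq0; apply: contraTT; rewrite -lt0n => ji.
apply/negP => /(dvdn_leq ji); rewrite leqNgt => /negP[].
by rewrite (leq_ltn_trans (leq_subr _ _)).
Qed.

End FundamentalUnit.

Theorem proposition2p8 (R : realType) (d : nat) (d_gt1 : (1 < d)%N)
    (d_sqf : squarefree d)
    (K : splittingFieldType rat) (iota : {rmorphism K -> R}) (sqrtd : K)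
    (sqrtdE : iota sqrtd = Num.sqrt d%:R)
    (K_gen : (<<1%VS; sqrtd>> = {: K})%VS)
    (p : nat) (p_prime : prime p)
    (p_inert : prime_ideal (principal (p%:R : K)))
    (u : K) (u_fund : fundamental_unit iota u) :
  ((p = 2%N -> normQ u = -1) ->
   forall k : nat, (1 <= k)%N ->
     (m_dp R p u <= k%:Z ->
      (set_card (Cl R (principal (p%:R ^+ k : K))))%:R =
        (p%:R ^+ 2 - 1) * p%:R ^ (k%:Z - 2 + m_dp R p u) / (s_dp R K p)%:R
          * (set_card (Cl R (@OK K)))%:R :> rat) /\
     (k%:Z <= m_dp R p u ->
      (set_card (Cl R (principal (p%:R ^+ k : K))))%:R =
        p%:R ^ (2 * k%:Z - 2) * (p%:R ^+ 2 - 1) / (s_dp R K p)%:R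
          * (set_card (Cl R (@OK K)))%:R :> rat)) /\
  (p = 2%N -> normQ u = 1 ->
   forall k : nat, (1 <= k)%N -> nu 2 (u ^+ 6 - 1) <= k%:Z ->
     set_card (Cl R (principal (2%:R ^+ k.+1 : K))) =
       (2 * set_card (Cl R (principal (2%:R ^+ k : K))))%N).
Proof.
have sq2 := sqrtd_sqr sqrtdE.
have [tau [tauN normE]] := exists_conj d_sqf d_gt1 sq2 K_gen.
have quadK := quadraticP d_sqf d_gt1 sq2 K_gen tauN.
have emb := embeddingP sqrtdE K_gen tauN.
have uu0 : units (u0 u) := units_u0 d_gt1 d_sqf sqrtdE K_gen tauN normE u_fund.
have tu0 : totally_positive R (u0 u) := tpos_u0 d_gt1 d_sqf sqrtdE K_gen tauN normE u_fund.
have gen0 := u0_generates d_gt1 d_sqf sqrtdE K_gen tauN normE u_fund.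
have neq1 := u0_neq1 d_gt1 d_sqf sqrtdE K_gen tauN normE u_fund.
have Ou0 : OK (u0 u) by case: uu0.
have OX n : OK (u0 u ^+ n - 1) by apply: OKB; [exact: OKX|exact: OK1].
have /choice[N /choice[t NtP]] : forall k, exists N t : nat, (0 < k)%N ->
    [/\ (0 < t)%N, (N * t = p ^ (2 * k.-1) * (p ^ 2 - 1))%N,
     forall n : nat, principal (p%:R ^+ k : K) (u0 u ^+ n - 1) <-> (t %| n)%N &
     set_card (Cl R (principal (p%:R ^+ k : K))) = (N * set_card (Cl R (@OK K)))%N].
  case=> [|k]; first by exists 0%N, 0%N.
  have [N [t Nt]] := ray_class_number quadK emb p_prime p_inert uu0 tu0 gen0 (ltn0Sn k).
  by exists N, t.
have tP k : (0 < k)%N -> forall n : nat,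
    principal (p%:R ^+ k : K) (u0 u ^+ n - 1) <-> (t k %| n)%N.
  by move=> /NtP[].
have sE : s_dp R K p = t 1%N.
  have [t0 _ tP1 _] := NtP 1%N isT.
  by apply: (s_dpE d_gt1 d_sqf sqrtdE K_gen tauN normE u_fund).
have t10 : (0 < t 1%N)%N by have [] := NtP 1%N isT.
have p0 : (0 < p)%N := prime_gt0 p_prime.
have pQ : (p%:R : rat) != 0 by rewrite pnatr_eq0 -lt0n.
have u0_cases := u0E d_gt1 d_sqf sqrtdE K_gen tauN normE u_fund.
split.
  move=> pN k k1.
  have [m hm] : exists m : nat, hasv p (u0 u ^+ t 1%N - 1) m%:Z.
    by apply: (hasv_OK quadK p_prime p_inert (OX _)); rewrite subr_eq0 neq1.
  have mE : m_dp R p u = m%:Z by rewrite /m_dp sE; exact: (nuE p_prime p_inert hm).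
  have m0 : (0 < m)%N.
    by apply/(principal_hasv p_prime p_inert 1 (OX _) hm)/tP.
  have pm : ((2 < p) || (1 < m))%N.
    have [p2|p2] := eqVneq p 2%N; last by rewrite ltn_neqAle eq_sym p2 prime_gt1.
    rewrite p2 /=; case: u0_cases => -[u0E nu]; have := pN p2; rewrite nu.
      move=> /eqP; rewrite -subr_eq0 opprK -[1 + 1]/(2%:R) K_natr_eq0 //.
    move=> _; apply/(principal_hasv p_prime p_inert 2 (OX _) hm).
    have Ou : OK u by case: u_fund => -[].
    have : principal (p%:R : K) (u0 u ^+ t 1%N - 1) by rewrite -[p%:R]expr1; apply/tP.
    rewrite u0E -exprM mulnC exprM => h; apply: principal2_sqr => //; first exact: OKX.
    (* Mod 2, [z ^ 2 - 1] is [(z - 1) ^ 2], so the prime 2 divides [z - 1]; squaring [z] then gains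
       a second factor 2. *)
    set z := u ^+ t 1%N in h *; have Oz : OK (z - 1) by apply: OKB; [exact: OKX|exact: OK1].
    rewrite expr1; case: p_inert => _ _ /(_ (z - 1) (z - 1) Oz Oz) [] //.
    have -> : (z - 1) * (z - 1) = (z ^+ 2 - 1) - p%:R * (z - 1) by rewrite p2; ring.
    by apply: principalB => //; apply/principalP; exists (z - 1).
  have [tk0 Nt _ ->] := NtP k k1; rewrite mE sE.
  have tQ : (t 1%N)%:R != 0 :> rat by rewrite pnatr_eq0 -lt0n.
  have NtQ : (N k)%:R * (t k)%:R = p%:R ^ (2 * k%:Z - 2) * (p%:R ^+ 2 - 1) :> rat.
    rewrite -natrM Nt natrM natrB ?expn_gt0 ?p0 // !natrX; congr (_ * _).
    by rewrite exprnP; congr (_ ^ _); lia.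
  split=> [|]; rewrite lez_nat => mk; rewrite natrM; congr (_ * _); apply: (mulIf tQ); rewrite divfK //.
    (* Dividing by [t k = t 1 * p ^ (k - m)] turns the exponent [2 k - 2] into [k - 2 + m]. *)
    have tk := order_ge_val p_prime p_inert Ou0 tP m0 pm mk t10 hm.
    have pkm : (p ^ (k - m))%:R != 0 :> rat by rewrite pnatr_eq0 -lt0n expn_gt0 p0.
    apply: (mulIf pkm); rewrite -mulrA -natrM -tk NtQ mulrC -mulrA; congr (_ * _).
    rewrite natrX exprnP -expfzDr //; congr (_ ^ _).
    by rewrite -subzn //; lia.
  have tk := order_le_val p_prime p_inert Ou0 tP k1 mk hm.
  by rewrite -tk NtQ.
move=> p2 nu k k1 nuk; subst p.
have uE : u0 u = u by rewrite /u0 nu eqxx.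
rewrite uE in tP OX neq1 Ou0.
have [m hm] : exists m : nat, hasv 2 (u ^+ 6 - 1) m%:Z.
  by apply: (hasv_OK quadK p_prime p_inert (OX _)); rewrite subr_eq0 neq1.
rewrite (nuE p_prime p_inert hm) lez_nat in nuk.
have m1 : (1 < m)%N.
  apply/(principal_hasv p_prime p_inert 2 (OX _) hm).
  (* [t 1] divides [N 1 * t 1 = 2 ^ 2 - 1 = 3], so [u ^ 3] is 1 mod 2 and its square is 1 mod 4. *)
  rewrite (exprM u 3 2); apply: principal2_sqr => //; first exact: OKX.
  apply/(tP _ (ltn0Sn 0)); have [_ Nt1 _ _] := NtP 1%N isT.
  by rewrite -[3%N]/(2 ^ (2 * 1.-1) * (2 ^ 2 - 1))%N -Nt1 dvdn_mull.
have [tk0 Ntk _ ->] := NtP k k1; have [_ Ntk1 _ ->] := NtP k.+1 isT.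
have tkE := order_double p_prime p_inert Ou0 tP erefl m1 nuk tk0 hm.
(* From [k] to [k + 1] the product [N * t] grows by the factor 4 and [t] by 2, so [N] doubles. *)
rewrite mulnA; congr (_ * _)%N; apply/eqP.
rewrite -(eqn_pmul2r (_ : 0 < 2 * t k)%N) ?muln_gt0 ?tk0 // -{1}tkE Ntk1.
rewrite mulnACA mulnA -[X in _ == X]mulnA Ntk /= mulnA -[(2 * 2)%N]/(2 ^ 2)%N -expnD.
by apply/eqP; congr (_ ^ _ * _)%N; lia.
Qed.
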